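(* Let $c\in(0,\infty)$. Consider a sequence of tuples $\mathbf{d}=(d_1,\dots,d_n)$ of natural numbers $d_j\ge 2$, where the length $n=n(\mathbf{d})\in\mathbb{N}$ and $p=p(\mathbf{d})\in\mathbb{N}$ may vary along the sequence, together with subsets $B_{\mathbf{d}}\subseteq\{0,1\}^{n(\mathbf{d})}$; all limits below are along this sequence. Let $\mu(\mathbf{d})=\min_{1\le j\le n}d_j$. Suppose that $\lim|B_{\mathbf{d}}|=\infty$ and that $$\lim |B_{\mathbf{d}}|^m\left(\frac{1}{\mu(\mathbf{d})}+\left|\frac{p}{d_1d_2\cdots d_n}-c\right|\right)=0$$ for all natural numbers $m$. Then the random matrices $$s_{\mathbf{d}}=\frac{1}{\sqrt{|B_{\mathbf{d}}|}}\sum_{x\in B_{\mathbf{d}}}\left(W^x_{d_1\cdots d_n,p}-c\cdot \mathrm{Id}_{d_1\cdots d_n}\right)$$ converge in moments to the semicircular element of mean $0$ and variance $c$, i.e. for every natural number $m$, $$\lim(\mathbb{E}\otimes\mathrm{tr})(s_{\mathbf{d}}^m)=\int_{-2\sqrt{c}}^{2\sqrt{c}}\frac{t^m}{2\pi c}\sqrt{4c-t^2}\,dt .$$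
   Context: $G=G_{d_1\cdots d_n,p}$ is a $d_1\cdots d_n\times p$ random matrix whose entries are independent standard complex Gaussian random variables (mean $0$, variance $1$, i.e. $\mathbb{E}(g)=0$, $\mathbb{E}(g^2)=0$, $\mathbb{E}(|g|^2)=1$). The Wishart matrix is $W=W_{d_1\cdots d_n,p}=\frac{1}{d_1\cdots d_n}GG^*\in M_{d_1\cdots d_n}(\mathbb{C})\cong M_{d_1}(\mathbb{C})\otimes\cdots\otimes M_{d_n}(\mathbb{C})$. For $x=(x_1,\dots,x_n)\in\{0,1\}^n$ the partial transpose is $W^x=(T_1^{x_1}\otimes\cdots\otimes T_n^{x_n})(W)$, where $T_j$ is the transpose map on $M_{d_j}(\mathbb{C})$, $T_j^1=T_j$, $T_j^0=\mathrm{id}$. $\mathrm{tr}=\frac1d\mathrm{Tr}$ is the normalized trace on $M_d(\mathbb{C})$, and $(\mathbb{E}\otimes\mathrm{tr})(A)=\mathbb{E}(\mathrm{tr}(A))$ for a random matrix $A$. *)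

(* Defs.v *)
From HB Require Import structures.
From mathcomp Require Export all_boot all_order all_algebra.
From mathcomp Require Export complex.
From mathcomp Require Export all_classical all_reals all_analysis.

Set Implicit Arguments.
Unset Strict Implicit.
Unset Printing Implicit Defensive.

Import Order.TTheory GRing.Theory Num.Theory.
Import numFieldNormedType.Exports.

Local Open Scope classical_set_scope.
Local Open Scope sesquilinear_scope.
Local Open Scope ring_scope.

Section Tensor.
Variables (n : nat) (d : 'I_n -> nat).

Definition tdim : nat := (\prod_(j < n) d j)%N.

Definition midx := {dffun forall j : 'I_n, 'I_(d j)}.

Lemma card_midx : #|{: midx}| = tdim.
Proof.
rewrite card_dep_ffun foldrE big_map /tdim -[RHS]big_enum /=.
by apply: eq_bigr => j _; rewrite card_ord.
Qed.

(* The basis of C^(d_0 ... d_(n-1)) is identified with the product basis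
   e_(a 0) (x) ... (x) e_(a (n-1)).  The order of the enumeration is that of
   the finite type midx, not specified as lexicographic: another order amounts
   to conjugating all matrices by one and the same permutation matrix. *)
Definition midx_of (a : 'I_tdim) : midx :=
  enum_val (cast_ord (esym card_midx) a).

Definition of_midx (a : midx) : 'I_tdim := cast_ord card_midx (enum_rank a).

Lemma midx_ofK : cancel midx_of of_midx.
Proof. by move=> a; rewrite /of_midx enum_valK cast_ordKV. Qed.

Lemma of_midxK : cancel of_midx midx_of.
Proof. by move=> a; rewrite /midx_of cast_ordK enum_rankK. Qed.

Variable K : comNzRingType.

Definition tens_mx (M : forall j, 'M[K]_(d j)) : 'M[K]_tdim :=
  \matrix_(a, b) \prod_(j < n) M j (midx_of a j) (midx_of b j).

(* The tensor product of linear maps: the linear extension of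
   E_(a 0, b 0) (x) ... |-> f_0 E_(a 0, b 0) (x) ... from the matrix units. *)
Definition tens_map (f : forall j, 'M[K]_(d j) -> 'M[K]_(d j))
    (A : 'M[K]_tdim) : 'M[K]_tdim :=
  \sum_(a < tdim) \sum_(b < tdim)
    A a b *: tens_mx (fun j => f j (delta_mx (midx_of a j) (midx_of b j))).

Definition ptranspose (x : {ffun 'I_n -> bool}) : 'M[K]_tdim -> 'M[K]_tdim :=
  tens_map (fun j => if x j then @trmx K (d j) (d j) else id).

Definition midx_mix (x : {ffun 'I_n -> bool}) (a b : 'I_tdim) : 'I_tdim :=
  of_midx [ffun j => if x j then midx_of b j else midx_of a j].

Lemma ptransposeE x (A : 'M[K]_tdim) a b :
  ptranspose x A a b = A (midx_mix x a b) (midx_mix x b a).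
Proof.
rewrite /ptranspose /tens_map summxE (bigD1 (midx_mix x a b)) //=.
rewrite summxE (bigD1 (midx_mix x b a)) //= !mxE.
have E c e : \prod_(j < n) (if x j then trmx else id)
      (delta_mx (midx_of c j) (midx_of e j)) (midx_of a j) (midx_of b j) =
    ((c == midx_mix x a b) && (e == midx_mix x b a))%:R :> K.
  have e1 j : (if x j then trmx else id)
      (delta_mx (midx_of c j) (midx_of e j)) (midx_of a j) (midx_of b j) =
      ((midx_of c j == (if x j then midx_of b j else midx_of a j)) &&
       (midx_of e j == (if x j then midx_of a j else midx_of b j)))%:R :> K.
    by case: (x j); rewrite !mxE eq_sym [X in _ && X]eq_sym.
  under eq_bigr do rewrite e1.
  have [/andP[/eqP-> /eqP->]|ne] := boolP (_ && _).
    by apply: big1 => j _; rewrite !of_midxK !ffunE !eqxx.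
  have [j jne] : exists j,
      ~~ ((midx_of c j == (if x j then midx_of b j else midx_of a j)) &&
       (midx_of e j == (if x j then midx_of a j else midx_of b j))).
    apply/existsP; apply: contraR ne => /existsPn H; apply/andP; split.
      apply/eqP; rewrite -(midx_ofK c); congr of_midx; apply/ffunP => j.
      by rewrite ffunE; have /negPn/andP[/eqP] := H j.
    apply/eqP; rewrite -(midx_ofK e); congr of_midx; apply/ffunP => j.
    by rewrite ffunE; have /negPn/andP[_ /eqP] := H j.
  by rewrite (bigD1 j) //= (negbTE jne) mul0r.
rewrite E !eqxx mulr1 big1 ?addr0; last first.
  by move=> e /negbTE ne; rewrite !mxE E ne andbF mulr0.
rewrite big1 ?addr0 // => c /negbTE nc; rewrite summxE big1 // => e _.
by rewrite !mxE E nc mulr0.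
Qed.

(* For n > 0 the default value max_j d_j does not affect the minimum. *)
Definition min_dim : nat :=
  \big[minn / (\max_(j < n) d j)%N]_(j < n) d j.

End Tensor.

Section Probability.
Context {disp : measure_display} {T : measurableType disp} {R : realType}.
Variable P : probability T R.

Definition coords (z : R[i]) : R * R := (complex.Re z, complex.Im z).

(* Real and imaginary parts are independent of law N(0, 1/2); the second
   parameter of normal_prob is the standard deviation. *)
Definition std_complex_gaussian (g : T -> R[i]) : Prop :=
  measurable_fun setT (coords \o g) /\
  forall A : set (R * R), measurable A ->
    P ((coords \o g) @^-1` A) =
      (normal_prob 0 (Num.sqrt 2^-1) \x normal_prob 0 (Num.sqrt 2^-1))%E A.

Definition independent_family (I : finType) (X : I -> T -> R[i]) : Prop :=
  forall (J : {set I}) (A : I -> set (R * R)),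
    (forall i, measurable (A i)) ->
    P (\bigcap_(i in [set` J]) ((coords \o X i) @^-1` A i)) =
      (\prod_(i in J) P ((coords \o X i) @^-1` A i))%E.

Definition gaussian_matrix (D p : nat) (G : T -> 'M[R[i]]_(D, p)) : Prop :=
  (forall i j, std_complex_gaussian (fun w => G w i j)) /\
  independent_family (fun (ij : 'I_D * 'I_p) w => G w ij.1 ij.2).

Definition cexpectation (X : T -> R[i]) : R[i] :=
  Complex (fine 'E_P[fun w => complex.Re (X w)])
          (fine 'E_P[fun w => complex.Im (X w)]).

Definition ntrace (D : nat) (A : 'M[R[i]]_D) : R[i] := D%:R^-1 * \tr A.

Definition expected_ntrace (D : nat) (A : T -> 'M[R[i]]_D) : R[i] :=
  cexpectation (fun w => ntrace (A w)).

End Probability.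

Section Wishart.
Context {R : realType}.

Definition wishart (D p : nat) (G : 'M[R[i]]_(D, p)) : 'M[R[i]]_D :=
  D%:R^-1 *: (G *m G^t*).

Variables (n : nat) (d : 'I_n -> nat) (p : nat).

Definition wishart_sum (c : R) (B : {set {ffun 'I_n -> bool}})
    (G : 'M[R[i]]_(tdim d, p)) : 'M[R[i]]_(tdim d) :=
  ((Num.sqrt #|B|%:R)^-1)%:C%C *:
    \sum_(x in B) (ptranspose x (wishart G) - (c%:C%C)%:M).

End Wishart.

Definition semicircle_moment {R : realType} (c : R) (m : nat) : R :=
  \int[lebesgue_measure]_(t in `[- (2 * Num.sqrt c), 2 * Num.sqrt c])
    (t ^+ m / (2 * pi * c) * Num.sqrt (4 * c - t ^+ 2)).

(* Main.v *)
Require Import Defs.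
From mathcomp Require Import fingroup perm zmodp measurable_realfun ring lra zify.

Set Implicit Arguments.
Unset Strict Implicit.
Unset Printing Implicit Defensive.

Import Order.TTheory GRing.Theory Num.Theory.
Import numFieldNormedType.Exports.

(** Write D for the product of the dimensions, r = p / D, and m = L + 1 for the
    order of the moment.  Expanding the trace of the m-th power gives a sum over
    words x in B^m, over closed walks a_0, a_1, ..., a_L, a_0 of row indices and
    over column indices k_0, ..., k_L.  The i-th factor (the slot i) is a product
    of an entry of G and of a conjugate entry of G in column k_i, minus a constant
    that centres the diagonal terms when r = c; in each tensor factor j, the rows
    of the two entries are a_i and a_(i+1), in an order that x_i decides.

    The Wick formula for centred products (centered_wick), which rests on
    Gaussian integration by parts (gaussian_ibp), turns the expectation into a sum
    over the permutations s of the slots, each fixed point of s contributing a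
    factor 1 - c / r.  Counting the indices that remain free gives an exact
    formula (expected_moment): s has the weight r^(number of cycles), and for each
    word x and each tensor factor j a factor d_j to the power
    cycles + wires - (m + 1), where the wires are the classes of row indices that
    s identifies.

    That exponent is never positive (genus_le).  The cycles and the wires are the
    vertices of a connected graph whose m edges are the slots, hence there are
    at most m + 1 of them, with equality when the graph is a tree.  On a tree
    every function on the edges is a coboundary, and testing this on the indicator
    function of one slot shows that s only matches slots transposed alike
    (genus0_stable).  So a word which is not constant along the cycles of s loses a
    factor 1 / min_j d_j, which beats every power of |B|.  Three cases remain.

    - If s has a fixed point, its weight 1 - c / r beats every power of |B|.
    - If s has no fixed point, only the |B|^(cycles) words constant along its
      cycles matter, against the normalisation |B|^(m/2).  If s is not an involution, it has fewer than m/2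
      cycles and its contribution vanishes (nclasses_noninvolution).
    - If s is an involution without fixed points, then a word constant on the
      pairs has the wires of the word without transpositions (nwires_involution),
      and the exponent is 0 exactly when s is noncrossing (genus0_noncrossing,
      noncrossing_genus0).

    Hence the limit of the m-th moment is c^(m/2) times the number of planar
    pairings of m points (moment_term_cvg, planar_sum).  Building the pairings
    point by point is counting ballot paths, which gives the Catalan numbers
    (ballot_number); the substitution t = 2 sqrt(c) sin(theta) and an integration
    by parts give the same recurrence for the semicircle moments
    (semicircle_momentSS). *)

(** * Functions constant along glued pairs *)

Section ClassCount.
Import boot.finset.
Local Open Scope set_scope.
Variables (I J : finType) (u w : J -> I).

Definition glue : rel I :=
  fun x y => [exists j, ((x == u j) && (y == w j)) || ((y == u j) && (x == w j))].

Definition nclasses : nat := n_comp glue I.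

Lemma glue_sym : connect_sym glue.
Proof. by apply: sym_connect_sym => x y; apply: eq_existsb => j; rewrite orbC. Qed.

Lemma glue_uw j : glue (u j) (w j).
Proof. by apply/existsP; exists j; rewrite !eqxx. Qed.

Lemma connect_glue_eq (V : Type) (a : I -> V) :
  (forall j, a (u j) = a (w j)) -> forall x y, connect glue x y -> a x = a y.
Proof.
move=> H x y /connectP[q]; elim: q x => [|z q IH] x /=; first by move=> _ ->.
case/andP=> /existsP[j /orP[/andP[/eqP-> /eqP Ez]|/andP[/eqP Ez /eqP->]]] pq Ey.
  by rewrite H -Ez; exact: IH.
by rewrite -H -Ez; exact: IH.
Qed.

Lemma root_glue j : fingraph.root glue (u j) = fingraph.root glue (w j).
Proof. by apply/eqP; rewrite root_connect ?connect1 ?glue_uw //; exact: glue_sym. Qed.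

(** Such a function is freely determined by its values on one representative of
    each class.  Read from right to left, this computes a number of classes
    from a number of functions. *)
Lemma card_glued (V : finType) :
  #|[set a : {ffun I -> V} | [forall j, a (u j) == a (w j)]]| = (#|V| ^ nclasses)%N.
Proof.
have -> : (#|V| ^ nclasses = #|{: {ffun {x | x \in fingraph.roots glue} -> V}}|)%N.
  rewrite card_ffun card_sig /nclasses /n_comp_mem; congr (_ ^ _)%N.
  by apply: eq_card => x; rewrite !inE andbT.
pose F (a : {ffun I -> V}) := [ffun x : {x | x \in fingraph.roots glue} => a (val x)].
rewrite -(card_in_imset (f := F)); last first.
  move=> a b; rewrite !inE => /forallP Ha /forallP Hb /ffunP E.
  apply/ffunP => x.
  have key (c : {ffun I -> V}) : (forall j, c (u j) == c (w j)) -> c x = c (fingraph.root glue x).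
    move=> Hc; apply: connect_glue_eq; first by move=> j; apply/eqP.
    exact: connect_root.
  have rx : fingraph.root glue x \in fingraph.roots glue by apply: roots_root; exact: glue_sym.
  by rewrite !key //; have := E (Sub (fingraph.root glue x) rx); rewrite !ffunE.
rewrite -[RHS]cardsT; congr #|pred_of_set _|; apply/setP => b; rewrite inE.
have rT x : fingraph.root glue x \in fingraph.roots glue by apply: roots_root; exact: glue_sym.
apply/imsetP; exists [ffun x => b (Sub (fingraph.root glue x) (rT x))].
  by rewrite inE; apply/forallP => j; rewrite !ffunE; apply/eqP; congr (b _);
     apply: val_inj; exact: root_glue.
apply/ffunP => -[x rx]; rewrite !ffunE /=; congr (b _); apply: val_inj => /=.
by apply/esym/eqP.
Qed.

Lemma card_glued_on (V : finType) (B : {set V}) :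
  #|[set a : {ffun I -> V} | (a \in ffun_on (mem B)) && [forall j, a (u j) == a (w j)]]| =
  (#|B| ^ nclasses)%N.
Proof.
have -> : #|B| = #|{: {x | x \in B}}| by rewrite card_sig; apply: eq_card => x; rewrite !inE.
rewrite -card_glued.
pose F (a : {ffun I -> {x | x \in B}}) := [ffun i => val (a i)].
have Finj : injective F.
  by move=> a b /ffunP E; apply/ffunP => i; apply: val_inj; have := E i; rewrite !ffunE.
rewrite -(card_imset _ Finj); apply: eq_card => a; rewrite inE.
apply/andP/imsetP => [[/ffun_onP aB /forallP H]|[b]].
  exists [ffun i => Sub (a i) (aB i)]; last by apply/ffunP => i; rewrite !ffunE.
  by rewrite inE; apply/forallP => j; rewrite !ffunE -val_eqE /=; exact: H.
rewrite inE => /forallP H ->; split.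
  by apply/ffun_onP => i; rewrite ffunE; exact: valP.
by apply/forallP => j; rewrite !ffunE (eqP (H j)).
Qed.

End ClassCount.

(** * The genus inequality *)

Section Genus.
Import boot.finset.
Local Open Scope set_scope.
Variable n : nat.
Implicit Types (b : 'I_n.+1 -> bool) (s : 'S_n.+1).

(** Slot i stands for the product of an entry of G and of a conjugate entry of G,
    in the rows a (slot_out b i) and a (slot_in b i) for a closed walk a; b i tells
    whether the slot is transposed.  Matching the entry of slot i with the
    conjugate entry of slot s i forces a (slot_out b i) = a (slot_in b (s i)), and
    equates the column indices of i and of s i.  So ncycles s and nwires b s are
    the numbers of column indices and of row indices that stay free. *)
Definition slot_out b (i : 'I_n.+1) := if b i then ordS i else i.
Definition slot_in b (i : 'I_n.+1) := if b i then i else ordS i.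

Definition ncycles s := nclasses id s.
Definition nwires b s := nclasses (slot_out b) (slot_in b \o s).

Local Open Scope ring_scope.

Lemma ord_ind_S (Q : 'I_n.+1 -> Prop) :
  Q ord0 -> (forall i, Q i -> Q (ordS i)) -> forall i, Q i.
Proof.
move=> Q0 QS [k lk]; elim: k lk => [|k IH] lk.
  by have -> : Ordinal lk = ord0 by apply: val_inj.
have lk' : (k < n.+1)%N by apply: ltnW.
have -> : Ordinal lk = ordS (Ordinal lk') by apply: val_inj; rewrite /= modn_small.
exact: QS.
Qed.

Section Coboundary.
Variable V : finZmodType.
Variables (b : 'I_n.+1 -> bool) (s : 'S_n.+1).

(** These are the vertex potentials, with values in V, of the bipartite graph whose
    vertices are the wires and the cycles and whose edges are the slots, slot i
    joining the wire of slot_out b i to the cycle of i. *)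
Definition glued_pairs :=
  setX [set a : {ffun 'I_n.+1 -> V} | [forall j, a (slot_out b j) == a ((slot_in b \o s) j)]]
       [set q : {ffun 'I_n.+1 -> V} | [forall j, q (id j) == q (s j)]].

(** The value at one vertex is recorded with the differences along the edges, so
    that a potential on a connected graph can be recovered. *)
Definition coboundary (aq : {ffun 'I_n.+1 -> V} * {ffun 'I_n.+1 -> V}) :
    {ffun 'I_n.+1 -> V} * V :=
  ([ffun i => aq.1 (slot_out b i) - aq.2 i], aq.1 ord0).

(** A step of the walk crosses two edges that share the cycle of i: the edges i
    and s^-1 i, in an order that depends on b i. This is why the graph is
    connected. *)
Lemma step_coboundary (a q : {ffun 'I_n.+1 -> V})
    (D : {ffun 'I_n.+1 -> V} := [ffun i => a (slot_out b i) - q i]) i :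
  (a, q) \in glued_pairs ->
  a (ordS i) = a i + (if b i then D i - D ((s^-1)%g i) else D ((s^-1)%g i) - D i).
Proof.
rewrite !inE /= => /andP[/forallP Ha /forallP Hq].
have E1 : a (slot_in b i) = D ((s^-1)%g i) + q i.
  rewrite ffunE; have /eqP/= -> := Ha ((s^-1)%g i); have /eqP -> := Hq ((s^-1)%g i).
  by rewrite permKV subrK.
have E2 : a (slot_out b i) = D i + q i by rewrite ffunE subrK.
move: E1 E2; rewrite /slot_in /slot_out; by case: (b i) => -> ->; rewrite [RHS]addrC [RHS]addrA subrK.
Qed.

Lemma coboundary_inj : {in glued_pairs &, injective coboundary}.
Proof.
move=> [a q] [a' q'] H H' [E E0].
have Ea : forall i, a i = a' i.
  apply: ord_ind_S => // i IH.
  by rewrite (step_coboundary i H) (step_coboundary i H') IH E.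
congr pair; apply/ffunP => // i.
have /ffunP/(_ i) := E; rewrite !ffunE Ea => /addrI/oppr_inj; exact.
Qed.

Lemma card_glued_pairs : #|glued_pairs| = (#|V| ^ (ncycles s + nwires b s))%N.
Proof.
rewrite cardsX expnD mulnC; congr (_ * _)%N.
  exact: (card_glued id s).
exact: (card_glued (slot_out b) (slot_in b \o s)).
Qed.

Lemma glued_pairs_le : (#|V| ^ (ncycles s + nwires b s) <= #|V| ^ n.+2)%N.
Proof.
rewrite -card_glued_pairs -(card_in_imset coboundary_inj).
apply: leq_trans (max_card _) _.
by rewrite card_prod card_ffun card_ord -expnSr.
Qed.

(** The hypothesis says that the graph is a tree, where every function on the edges
    is a coboundary. *)
Lemma coboundary_onto : (#|V| ^ (ncycles s + nwires b s) = #|V| ^ n.+2)%N ->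
  forall y, exists2 aq, aq \in glued_pairs & coboundary aq = y.
Proof.
move=> E y; suff /imsetP[aq] : y \in coboundary @: glued_pairs by exists aq.
suff -> : coboundary @: glued_pairs = setT by rewrite inE.
apply/eqP; rewrite eqEcard subsetT /= cardsT card_prod card_ffun card_ord -expnSr -E.
by rewrite card_in_imset ?card_glued_pairs //; exact: coboundary_inj.
Qed.

End Coboundary.

(** A connected graph with n + 1 edges has at most n + 2 vertices. *)
Lemma genus_le b s : (ncycles s + nwires b s <= n.+2)%N.
Proof. by have := glued_pairs_le 'I_2 b s; rewrite card_ord leq_exp2l. Qed.

(** Take a potential whose coboundary is the indicator function of the slot i0.
    Along the closed walk it changes only at the steps i0 and s i0, by 1 or -1
    according to b, and the total change is 0. *)
Lemma genus0_stable b s : (ncycles s + nwires b s = n.+2)%N -> forall i, b (s i) = b i.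
Proof.
move=> E i0.
(* values modulo 3, where the signs 1 and -1 differ *)
have [] := coboundary_onto (V := 'I_3) (b := b) (s := s) _ ([ffun i => (i == i0)%:R : 'Z_3], 0).
  by rewrite E.
move=> [a q] H [ED _].
pose sg i : 'Z_3 := if b i then -1 else 1.
pose D : 'I_n.+1 -> 'Z_3 := fun i => (i == i0)%:R.
have step i : (a (ordS i) : 'Z_3) = (a i : 'Z_3) + sg i * (D ((s^-1)%g i) - D i).
  rewrite (step_coboundary i H) ED !ffunE /sg /D; congr (_ + _).
  by case: (b i); rewrite ?mulN1r ?opprB ?mul1r.
have tour : \sum_i (a (ordS i) : 'Z_3) = \sum_i (a i : 'Z_3).
  rewrite [RHS](reindex_inj (h := @ordS n.+1)) //=.
  exact: (can_inj (@ordSK n.+1)).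
have S0 : \sum_i sg i * (D ((s^-1)%g i) - D i) = 0.
  move: tour; under eq_bigr do rewrite step.
  by rewrite big_split /= -[RHS]addr0 => /addrI.
have : sg (s i0) - sg i0 = 0.
  rewrite -S0; under [RHS]eq_bigr do rewrite mulrBr.
  rewrite sumrB; congr (_ - _).
    rewrite (bigD1 (s i0)) //= /D permK eqxx mulr1 big1 ?addr0 // => i ne.
    case: eqP => [e|_]; last by rewrite mulr0.
    by rewrite -e permKV eqxx in ne.
  by rewrite (bigD1 i0) //= /D eqxx mulr1 big1 ?addr0 // => i /negbTE->; rewrite mulr0.
by rewrite /sg; case: (b (s i0)); case: (b i0).
Qed.
End Genus.

(** * Cycles of permutations without fixed points *)

Section Cycles.
Import boot.finset boot.fintype.
Local Open Scope set_scope.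
Variables (I : finType) (s : {perm I}).
Local Notation cls := (fingraph.root (glue id s)).
Local Notation R := [set x | x \in fingraph.roots (glue id s)].

Lemma nclasses_roots : nclasses id s = #|R|.
Proof. by rewrite /nclasses /n_comp_mem; apply: eq_card => x; rewrite !inE andbT. Qed.

Lemma root_perm x : cls (s x) = cls x.
Proof. by have := root_glue (id : I -> I) s x. Qed.

Lemma roots_disjoint_image : (forall x, s x != x) -> [disjoint R & s @: R].
Proof.
move=> ds; rewrite disjoint_subset; apply/subsetP => x; rewrite !inE => /eqP rx.
apply/negP => /imsetP[y]; rewrite inE => /eqP ry E.
by have := ds y; rewrite -E -rx E root_perm ry eqxx.
Qed.

Lemma two_point_class x y : s (s x) = x -> cls x = cls y -> (y == x) || (y == s x).
Proof.
move=> ssx /eqP; rewrite root_connect; last exact: glue_sym.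
move=> xy; pose a z := (z == x) || (z == s x).
have -> : (y == x) || (y == s x) = a y by [].
rewrite -(@connect_glue_eq _ _ id s _ a _ x y xy) /a ?eqxx // => z.
rewrite -[in RHS]ssx !(inj_eq perm_inj) orbC; congr (_ || _).
by rewrite ssx.
Qed.

(** The representatives of the classes and their images under s are disjoint,
    and here they exhaust the points. *)
Lemma nclasses_involution : (forall x, s x != x) -> involutive s ->
  ((nclasses id s).*2 = #|I|)%N.
Proof.
move=> ds ss; rewrite nclasses_roots -addnn -{2}(card_imset _ (@perm_inj _ s)).
have /eqP <- : #|R :|: s @: R| == (#|R| + #|s @: R|)%N.
  by rewrite cardsU; have /disjoint_setI0 -> := roots_disjoint_image ds; rewrite cards0 subn0.
rewrite -cardsT; congr #|pred_of_set _|; apply/setP => x; rewrite !inE.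
have rr : cls x \in R.
  by rewrite inE; apply: roots_root; exact: glue_sym.
have rrE : cls (cls x) = cls x by move: rr; rewrite inE => /eqP.
have [Ex|/= Ex] := orP (two_point_class (ss (cls x)) rrE).
  by rewrite /fingraph.roots -(eqP Ex) -topredE /= eqxx.
by apply/orP; right; apply/imsetP; exists (cls x) => //; exact/eqP.
Qed.

(** If r represents the class of a point with s (s r) distinct from r, then
    s (s r) is neither a representative nor the image of one. *)
Lemma nclasses_noninvolution : (forall x, s x != x) -> ~ involutive s ->
  ((nclasses id s).*2 < #|I|)%N.
Proof.
move=> ds nss; rewrite nclasses_roots -addnn -{2}(card_imset _ (@perm_inj _ s)).
have [/forallP/= H|/forallPn[i /eqP ssi]] := boolP [forall i, s (s i) == i].
  by case: nss => i; apply/eqP.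
have /eqP <- : #|R :|: s @: R| == (#|R| + #|s @: R|)%N.
  by rewrite cardsU; have /disjoint_setI0 -> := roots_disjoint_image ds; rewrite cards0 subn0.
rewrite -[X in (_ < X)%N]cardsT; apply: proper_card; rewrite properT.
set r := cls i; have rr : cls r = r.
  by apply/eqP; apply: roots_root; exact: glue_sym.
have ssr : s (s r) != r.
  apply/eqP => ssr; have [/eqP ir|/eqP ir] := orP (two_point_class ssr rr).
    by apply: ssi; rewrite ir.
  by apply: ssi; rewrite ir ssr.
apply/eqP => /setP/(_ (s (s r))); rewrite in_setU in_setT => /orP[].
  by rewrite inE => /eqP; rewrite !root_perm rr => E; rewrite -E eqxx in ssr.
move=> /imsetP[y]; rewrite inE => /eqP ry /perm_inj E.
have : cls (s r) = cls y by rewrite E.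
by rewrite root_perm rr ry => E'; have := ds r; rewrite E -E' eqxx.
Qed.

End Cycles.

(** * Planar pairings have genus 0 *)

Section PlanarPairings.
Variables (m : nat) (s : 'S_m).

Definition fpf_involution := [forall i, (s i != i) && (s (s i) == i)].

Definition noncrossing :=
  [forall i : 'I_m, forall k : 'I_m, (i < k < s i)%N ==> (i < s k < s i)%N].

Definition planar_pairing := fpf_involution && noncrossing.

End PlanarPairings.

Definition planar_count m := #|[pred s : 'S_m | planar_pairing s]|.

Section Planar.
Import boot.finset boot.fintype.
Local Open Scope set_scope.
Variable n : nat.
Implicit Types (b : 'I_n.+1 -> bool) (s : 'S_n.+1).

(** For an involution, transposing both slots i and s i exchanges the two
    identifications of row indices that these slots impose. *)
Lemma nwires_involution b s : involutive s -> (forall i, b (s i) = b i) ->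
  nwires b s = nwires (fun=> false) s.
Proof.
move=> ss bs.
suff H : (#|{: bool}| ^ nwires b s = #|{: bool}| ^ nwires (fun=> false) s)%N.
  by rewrite card_bool in H; exact: (@expnI 2 isT _ _ H).
apply: etrans (esym (card_glued (slot_out b) (slot_in b \o s) bool)) _.
apply: etrans _ (card_glued (slot_out (fun=> false)) (slot_in (fun=> false) \o s) bool).
congr #|pred_of_set _|; apply/setP => a; rewrite !inE.
apply/forallP/forallP => H j; have := H j; have := H (s j); rewrite /slot_in /slot_out /=;
 rewrite !ss !bs; case: (b j) => //.
- by move=> /eqP -> _.
- by rewrite eq_sym.
Qed.

Local Open Scope ring_scope.

(** The walk is followed without passing from the last index back to 0, so that
    the steps taken form an interval. *)
Lemma walk_sum (V : zmodType) (a f : 'I_n.+1 -> V) (i j : 'I_n.+1) : (i <= j)%N ->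
  (forall t : 'I_n.+1, (i <= t < j)%N -> a (ordS t) = a t + f t) ->
  a j = a i + \sum_(t < n.+1 | (i <= t < j)%N) f t.
Proof.
case: j => [j lj]; elim: j lj => [|j IH] lj /= ij step.
  rewrite big1 => [|t]; last by rewrite ltn0 andbF.
  by rewrite addr0; congr a; apply: val_inj => /=; lia.
have lj' : (j < n.+1)%N by apply: ltnW.
have Sj : Ordinal lj = ordS (Ordinal lj') by apply: val_inj; rewrite /= modn_small.
have [eij|neij] := eqVneq (i : nat) j.+1.
  rewrite big1 => [|t]; last by rewrite -eij; lia.
  by rewrite addr0; congr a; apply: val_inj => /=.
have ij' : (i <= Ordinal lj')%N by rewrite /=; lia.
rewrite Sj step /=; last by lia.
rewrite (IH lj' ij') /=; last by move=> t /= H; apply: step; lia.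
rewrite [in RHS](bigD1 (Ordinal lj')) /=; last by lia.
rewrite -addrA; congr (_ + _); rewrite addrC; congr (_ + _).
by apply: eq_bigl => t; rewrite -(inj_eq val_inj) /=; lia.
Qed.

Lemma stable_sum0 (V : zmodType) (D : 'I_n.+1 -> V) s (A : pred 'I_n.+1) :
  (forall t, A (s t) = A t) -> \sum_(t | A t) (D (s t) - D t) = 0.
Proof.
move=> As; rewrite sumrB [X in X - _](_ : _ = \sum_(t | A t) D t) ?subrr //.
rewrite [RHS](reindex_inj (h := s)) /=; last exact: perm_inj.
by apply: eq_bigl => t; rewrite As.
Qed.

(** Suppose that i < k0 < s i and that s k0 lies outside.  A potential whose
    coboundary is the indicator function of k0 changes exactly once between
    i + 1 and s i, although these two indices lie on the same wire. *)
Lemma genus0_noncrossing s : fpf_involution s ->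
  (ncycles s + nwires (fun=> false) s = n.+2)%N -> noncrossing s.
Proof.
move=> /forallP inv E; apply/forallP => i; apply/forallP => k0; apply/implyP => ik0.
have ss x : s (s x) = x by have /andP[_ /eqP] := inv x.
apply: contraT => nk.
have [] := coboundary_onto (V := 'I_2) (b := fun=> false) (s := s) _ ([ffun j => (j == k0)%:R : 'Z_2], 0).
  by rewrite E.
move=> [a q] H [ED _].
pose D (j : 'I_n.+1) : 'Z_2 := (j == k0)%:R.
have step j : (a (ordS j) : 'Z_2) = (a j : 'Z_2) + (D (s j) - D j).
  rewrite (step_coboundary j H) ED !ffunE /D.
  suff -> : (s^-1)%g j = s j by [].
  by apply: (@perm_inj _ s); rewrite permKV ss.
have wj : a (ordS i) = a (s i).
  have := H; rewrite inE /= => /andP[]; rewrite !inE => /forallP/(_ (s i)).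
  by rewrite /slot_out /slot_in /= ss => /eqP.
have li : (i.+1 < n.+1)%N by have := ltn_ord (s i); lia.
have Si : ordS i = i.+1 :> nat by rewrite /= modn_small.
have := @walk_sum 'Z_2 a (fun j => D (s j) - D j) (ordS i) (s i) _ (fun t _ => step t).
rewrite wj Si => /(_ ltac:(lia)); rewrite -[X in X = _]addr0 => /addrI.
rewrite sumrB [X in X - _]big1; last first.
  move=> t Ht; rewrite /D; case: eqP => // e; move: nk; rewrite -e ss; lia.
rewrite (bigD1 k0) /=; last by lia.
rewrite /D eqxx big1 // => t /andP[_ /negbTE ->] //.
Qed.

(** It suffices to count 2^(n + 2) potentials, so to show that every function D on
    the edges is a coboundary modulo 2.  The steps D (s t) - D t define a along the
    walk, and a is constant on the wires because the points under an arc are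
    permuted by s, so that their steps cancel. *)
Lemma noncrossing_genus0 s : fpf_involution s -> noncrossing s ->
  (ncycles s + nwires (fun=> false) s = n.+2)%N.
Proof.
move=> /forallP inv /forallP nc.
have ss x : s (s x) = x by have /andP[_ /eqP] := inv x.
have sN x : s x != x by have /andP[] := inv x.
apply/eqP; rewrite eqn_leq genus_le /= -(@leq_exp2l 2) //.
rewrite -[2%N]card_ord -card_glued_pairs.
have -> : (#|'I_2| ^ n.+2 = #|{: {ffun 'I_n.+1 -> 'Z_2} * 'Z_2}|)%N.
  by rewrite card_prod card_ffun !card_ord -expnSr.
apply: leq_trans (leq_imset_card (@coboundary n 'I_2 (fun=> false)) _).
rewrite -cardsT; apply: subset_leq_card; apply/subsetP => -[D z] _.
pose f j := D (s j) - D j.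
pose a : {ffun 'I_n.+1 -> 'Z_2} := [ffun i : 'I_n.+1 => z + \sum_(t < n.+1 | (t < i)%N) f t].
have tot : \sum_t f t = 0 by apply: (@stable_sum0 'Z_2 D s xpredT).
have step i : a (ordS i) = a i + f i.
  rewrite !ffunE; have [li|li] := ltnP i.+1 n.+1.
    rewrite -addrA; congr (_ + _); rewrite (bigD1 i) /=; last by rewrite modn_small.
    rewrite addrC; congr (_ + _); apply: eq_bigl => t.
    by rewrite modn_small // -(inj_eq val_inj) /=; lia.
  have ei : i = n :> nat by have := ltn_ord i; lia.
  rewrite /= ei modnn big_pred0_eq addr0 -addrA -[LHS]addr0; congr (_ + _).
  rewrite -[LHS]tot [LHS](bigD1 i) //= [LHS]addrC; congr (_ + _); apply: eq_bigl => t.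
  by rewrite -(inj_eq val_inj) /=; have := ltn_ord t; lia.
have wire i : a i = a (ordS (s i)).
  have gen (j : 'I_n.+1) : (j < s j)%N -> a (ordS (s j)) = a j /\ a (s j) = a (ordS j).
    move=> lj.
    (* an arc and the points that it covers form a set stable under s *)
    have st (t : 'I_n.+1) : (j < s t < s j)%N = (j < t < s j)%N.
      have ncj (k : 'I_n.+1) := implyP (forallP (nc j) k).
      by apply/idP/idP => H; [rewrite -[t]ss; apply: ncj|apply: ncj].
    have Sj : ordS j = j.+1 :> nat by rewrite /= modn_small //; have := ltn_ord (s j); lia.
    split.
      rewrite step (@walk_sum 'Z_2 a f j (s j)) //; last by lia.
      rewrite -addrA -[RHS]addr0; congr (_ + _).
      rewrite -[RHS](@stable_sum0 'Z_2 D s (fun t : 'I_n.+1 => (j <= t <= s j)%N)).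
        rewrite [RHS](bigD1 (s j)) /=; last by lia.
        rewrite addrC; congr (_ + _); apply: eq_bigl => t.
        by rewrite -(inj_eq val_inj) /=; lia.
      move=> t; have [->|n1] := eqVneq t j; first by lia.
      have [->|n2] := eqVneq t (s j); first by rewrite ss; lia.
      have n3 : s t != s j by rewrite (inj_eq perm_inj).
      have n4 : s t != j by rewrite -[j]ss (inj_eq perm_inj).
      have := st t; move: n1 n2 n3 n4; rewrite -!(inj_eq val_inj) /=; lia.
    rewrite (@walk_sum 'Z_2 a f (ordS j) (s j)) //; last by rewrite Sj.
    rewrite -[RHS]addr0; congr (_ + _); rewrite Sj.
    exact: (@stable_sum0 'Z_2 D s (fun t : 'I_n.+1 => (j < t < s j)%N)).
  have [l|l|/val_inj e] := ltngtP i (s i).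
  - by have [] := gen i l.
  - by have := gen (s i); rewrite ss => /(_ l) [_ ->].
  - by have := sN i; rewrite -e eqxx.
apply/imsetP; exists (a, [ffun i => a i - D i]); last first.
  congr pair; last by rewrite ffunE big_pred0_eq addr0.
  by apply/ffunP => i; rewrite !ffunE /= /slot_out /= opprB addrC subrK.
rewrite inE /=; apply/andP; split; rewrite inE; apply/forallP => i; apply/eqP.
  by rewrite /slot_out /slot_in /=; exact: wire.
rewrite ![[ffun i => a i - D i] _]ffunE.
have := wire i; rewrite step /f ss => ->.
by rewrite [D i - _]addrC addrA addrK.
Qed.
End Planar.

(** * Counting planar pairings *)

Section Ballot.
Import boot.finset boot.fintype.
Local Open Scope set_scope.
Variable N : nat.
Implicit Types (s t : 'S_N) (m j : nat).

(** The pairings obtained by reading the first m of N points from left to right: a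
    fixed point below m is open, that is, still waits for a partner on its
    right, and so cannot lie under an arc. They are all permutations of the same N
    points, so that m may vary in a recurrence. *)
Definition half_pairing m s :=
  [&& [forall i : 'I_N, (m <= i) ==> (s i == i)], [forall i, s (s i) == i] &
      [forall i : 'I_N, forall k : 'I_N,
         (i < k < s i) ==> [&& i < s k, s k < s i & s k != k]]].

Definition open_points m s := #|[set i : 'I_N | (i < m) && (s i == i)]|.

Definition half_pairings m j := [set s | half_pairing m s && (open_points m s == j)].

Lemma half_pairingP m s : reflect
  [/\ forall i : 'I_N, m <= i -> s i = i, forall i, s (s i) = i &
      forall i k : 'I_N, i < k < s i -> [/\ i < s k, s k < s i & s k <> k]]
  (half_pairing m s).
Proof.
apply: (iffP and3P) => -[H1 H2 H3]; split.
- by move=> i mi; apply/eqP; apply: (implyP (forallP H1 i)).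
- by move=> i; apply/eqP/(forallP H2).
- move=> i k ik; have /and3P[? ? /eqP ?] := implyP (forallP (forallP H3 i) k) ik.
  by split.
- by apply/forallP => i; apply/implyP => mi; apply/eqP/H1.
- by apply/forallP => i; apply/eqP.
- apply/forallP => i; apply/forallP => k; apply/implyP => /H3[-> -> /eqP ->] //.
Qed.

Lemma half_pairing_lt m s (i : 'I_N) : half_pairing m s -> i < m -> s i < m.
Proof.
move=> /half_pairingP[H1 H2 _] im; rewrite ltnNge; apply/negP => mi.
by have := H1 _ mi; rewrite H2 => e; move: mi; rewrite -e; lia.
Qed.

Lemma half_pairings0 j : #|half_pairings 0 j| = (j == 0).
Proof.
have E : half_pairings 0 j = if j == 0 then [set 1%g] else set0.
  apply/setP => s; rewrite inE /open_points.
  rewrite [X in #|pred_of_set X|](_ : _ = set0) ?cards0; last first.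
    by apply/setP => i; rewrite !inE.
  rewrite eq_sym; case: (j == 0); rewrite !inE ?andbF ?andbT //.
  apply/half_pairingP/eqP => [[H1 _ _]|->].
    by apply/permP => i; rewrite perm1 H1.
  by split=> [i _|i|i k]; rewrite !perm1 //; lia.
by rewrite E; case: (j == 0); rewrite ?cards1 ?cards0.
Qed.

Section Step.
Variables (m : nat) (lm : m < N).
Let M : 'I_N := Ordinal lm.

Lemma open_points_fixed s : s M = M -> open_points m.+1 s = (open_points m s).+1.
Proof.
move=> sM; rewrite /open_points (cardsD1 M) inE /= sM eqxx ltnSn /= add1n; congr _.+1.
by apply: eq_card => i; rewrite !inE -(inj_eq val_inj) /=; case: (s i == i); lia.
Qed.

Lemma half_pairings_fixed j :
  [set s in half_pairings m.+1 j.+1 | s M == M] = half_pairings m j.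
Proof.
apply/setP => s; rewrite !inE; apply/idP/idP => [/andP[/andP[H O] /eqP sM]|/andP[H O]].
  rewrite open_points_fixed // eqSS in O; rewrite O andbT.
  have /half_pairingP[H1 H2 H3] := H; apply/half_pairingP; split=> // i mi.
  have [e|ne] := eqVneq (i : nat) m; first by have -> : i = M by apply: val_inj.
  by apply: H1; lia.
have /half_pairingP[H1 H2 H3] := H.
have sM : s M = M by apply: H1.
rewrite sM eqxx open_points_fixed // eqSS O /= !andbT; apply/half_pairingP; split=> // i mi.
by apply: H1; lia.
Qed.

Lemma half_pairings_fixed0 : [set s in half_pairings m.+1 0 | s M == M] = set0.
Proof.
apply/setP => s; rewrite !inE; apply/negP => /andP[/andP[_ O] /eqP sM].
by rewrite open_points_fixed in O.
Qed.

(** The transposition removes the arc that ends at the last point M and makes the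
    partner of M open again. *)
Definition unpair s : 'S_N := (s * tperm M (s M))%g.

Lemma unpairE s i : half_pairing m.+1 s ->
  unpair s i = if (i == M) || (i == s M) then i else s i.
Proof.
move=> /half_pairingP[_ ss _]; rewrite /unpair permM.
have [->|n1] := eqVneq i M; first by rewrite tpermR.
have [->|n2] /= := eqVneq i (s M); first by rewrite ss tpermL.
rewrite tpermD //; last by rewrite (inj_eq perm_inj) eq_sym.
by apply: contraNneq n2 => ->; rewrite ss.
Qed.

Lemma partner_lt s : half_pairing m.+1 s -> s M != M -> s M < m.
Proof.
move=> H; have := half_pairing_lt H (ltnSn m : M < m.+1).
by rewrite -(inj_eq val_inj) /=; lia.
Qed.

Lemma unpair_half_pairing s : half_pairing m.+1 s -> s M != M -> half_pairing m (unpair s).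
Proof.
move=> H sM; have kM := partner_lt H sM; have /half_pairingP[H1 ss H3] := H.
apply/half_pairingP; split=> [i mi|i|i k].
- rewrite unpairE //; case: ifP => // /negbT; rewrite negb_or => /andP[n1 n2].
  by apply: H1; move: n1; rewrite -(inj_eq val_inj) /=; lia.
- rewrite [unpair s i]unpairE //; case: ifP => [c|/norP[n1 n2]].
    by rewrite unpairE // c.
  rewrite unpairE // ss ifN // negb_or (inj_eq perm_inj) n1 andbT.
  by apply: contra n2 => /eqP <-; rewrite ss.
- rewrite !unpairE //; case: ifP => [_|/norP[n1 n2]]; first by lia.
  move=> iks; have [a1 a2 a3] := H3 _ _ iks.
  have sim : s i < m.+1.
    by apply: (half_pairing_lt H); rewrite ltnNge; apply/negP => /H1 e; move: iks; rewrite e; lia.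
  have kM' : k != M by apply/eqP => e; move: iks; rewrite e /=; lia.
  have ksM : k != s M by apply/eqP => e; move: a2; rewrite e ss /=; lia.
  by rewrite (negbTE kM') (negbTE ksM).
Qed.

Lemma open_points_unpair s : half_pairing m.+1 s -> s M != M ->
  open_points m (unpair s) = (open_points m.+1 s).+1.
Proof.
move=> H sM; have kM := partner_lt H sM; have /half_pairingP[H1 ss H3] := H.
rewrite /open_points (cardsD1 (s M)) inE kM unpairE // eqxx orbT eqxx /= add1n; congr _.+1.
apply: eq_card => i; rewrite !inE unpairE //.
have [->|n1] := eqVneq i M; first by rewrite (negbTE sM) /= ltnn !andbF.
have [->|n2] /= := eqVneq i (s M).
  by rewrite ss [_ == s M]eq_sym (negbTE sM) andbF.
by move: n1; rewrite -(inj_eq val_inj) /=; case: (s i == i); lia.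
Qed.

(** The points between the partner of M and M were covered by the erased arc, so
    none of them is open.  Hence the erased arc can be recovered. *)
Lemma partner_last s (k : 'I_N) : half_pairing m.+1 s -> s M != M ->
  s M < k -> k < m -> unpair s k != k.
Proof.
move=> H sM sk km; have /half_pairingP[H1 ss H3] := H.
have [|_ _ /eqP] := H3 (s M) k; first by rewrite ss sk.
rewrite unpairE // ifN // negb_or -!(inj_eq val_inj) /=; lia.
Qed.

Lemma unpair_inj : {in [set s | half_pairing m.+1 s & s M != M] &, injective unpair}.
Proof.
move=> s t; rewrite !inE => /andP[Hs sM] /andP[Ht tM] E.
have ks := partner_lt Hs sM; have kt := partner_lt Ht tM.
have e : s M = t M.
  apply: val_inj; case: (ltngtP (s M) (t M)) => // l.
    by have := partner_last Hs sM l kt; rewrite E unpairE // eqxx orbT eqxx.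
  by have := partner_last Ht tM l ks; rewrite -E unpairE // eqxx orbT eqxx.
by move: E; rewrite /unpair e => /mulIg.
Qed.

(** Joining M to the last open point covers no open point. *)
Lemma unpair_onto t : half_pairing m t -> 0 < open_points m t ->
  exists s, [/\ half_pairing m.+1 s, s M != M & unpair s = t].
Proof.
move=> H; rewrite card_gt0 => /set0Pn[k0 Hk0].
have /half_pairingP[H1 tt H3] := H.
case: (@arg_maxnP _ k0 (mem [set i : 'I_N | (i < m) && (t i == i)]) (fun i => i : nat) Hk0) => k.
rewrite !inE => /andP[km /eqP tk] kmax.
have {kmax} klast (i : 'I_N) : k < i -> i < m -> t i <> i.
  by move=> ki im /eqP ti; have := kmax i; rewrite /= !inE im ti => /(_ isT); lia.
have tM : t M = M by exact: H1.
have nkM : k != M by rewrite -(inj_eq val_inj) /=; lia.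
pose s := (t * tperm M k)%g.
have sE i : s i = if i == M then k else if i == k then M else t i.
  rewrite /s permM; have [->|n1] := eqVneq i M; first by rewrite tM tpermL.
  have [->|n2] := eqVneq i k; first by rewrite tk tpermR.
  by rewrite tpermD // eq_sym -1?[X in _ != X]tM -1?[X in _ != X]tk (inj_eq perm_inj).
have sM : s M = k by rewrite sE eqxx.
have ss i : s (s i) = i.
  rewrite [s i]sE; have [->|n1] := eqVneq i M; first by rewrite sE (negbTE nkM) eqxx.
  have [->|n2] := eqVneq i k; first by rewrite sM.
  have e1 : (t i == M) = false by rewrite -tM (inj_eq perm_inj) (negbTE n1).
  have e2 : (t i == k) = false by rewrite -tk (inj_eq perm_inj) (negbTE n2).
  by rewrite sE e1 e2 tt.
exists s; split; last by rewrite /unpair sM /s -mulgA tperm2 mulg1.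
  apply/half_pairingP; split=> // [i mi|i x].
    rewrite sE ifN; last by rewrite -(inj_eq val_inj) /=; lia.
    rewrite ifN; last by rewrite -(inj_eq val_inj) /=; lia.
    by apply: H1; lia.
  rewrite !sE; have [->|niM] := eqVneq i M; first by rewrite /=; lia.
  have [->|nik] := eqVneq i k.
    rewrite /= => /andP[kx xm].
    rewrite ifN; last by rewrite -(inj_eq val_inj) /=; lia.
    rewrite ifN; last by rewrite -(inj_eq val_inj) /=; lia.
    have nx := klast _ kx xm.
    split=> //; last exact: half_pairing_lt H xm.
    rewrite ltnNge; apply/negP; rewrite leq_eqVlt => /orP[/eqP/val_inj e|l].
      by apply: nx; rewrite -{2}[x]tt e tk.
    by have [|_ _] := H3 (t x) k; [rewrite l tt|rewrite tk].
  move=> ixt; have [a1 a2 a3] := H3 _ _ ixt.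
  have tim : t i < m by apply: (half_pairing_lt H); rewrite ltnNge; apply/negP => /H1 e; move: ixt; rewrite e; lia.
  rewrite ifN; last by rewrite -(inj_eq val_inj) /=; lia.
  by rewrite ifN //; apply: contra_notN a3 => /eqP ->.
by rewrite sM.
Qed.

Lemma card_paired j :
  #|[set s in half_pairings m.+1 j | s M != M]| = #|half_pairings m j.+1|.
Proof.
rewrite -(card_in_imset (f := unpair)); last first.
  move=> s t; rewrite !inE => /andP[/andP[Hs _] sM] /andP[/andP[Ht _] tM].
  by apply: unpair_inj; rewrite inE ?Hs ?Ht.
apply: eq_card => t; apply/imsetP/idP => [[s]|].
  rewrite !inE => /andP[/andP[Hs /eqP O] sM] ->.
  by rewrite unpair_half_pairing // open_points_unpair // O eqxx.
rewrite !inE => /andP[Ht /eqP O].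
have [|s [Hs sM E]] := unpair_onto Ht; first by rewrite O.
exists s => //; rewrite !inE Hs sM andbT /= -eqSS -open_points_unpair // E O //.
Qed.

(** The point m either is open or closes an arc. *)
Lemma card_half_pairingsS j : #|half_pairings m.+1 j| =
  (if j is j'.+1 then #|half_pairings m j'| else 0) + #|half_pairings m j.+1|.
Proof.
rewrite -(cardsID [set s : 'S_N | s M == M]); congr (_ + _).
  case: j => [|j]; last by rewrite -half_pairings_fixed; congr #|pred_of_set _|; apply/setP => s; rewrite !inE.
  by rewrite -[RHS](cards0 'S_N) -half_pairings_fixed0; congr #|pred_of_set _|; apply/setP => s; rewrite !inE.
by rewrite -card_paired; congr #|pred_of_set _|; apply/setP => s; rewrite !inE andbC.
Qed.
End Step.

(** These are the ballot numbers (j + 1) / (a + j + 1) 'C(m, a), the solution of the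
    recurrence of card_half_pairingsS; denominators are cleared. *)
Lemma ballot_number m j : m <= N ->
  (m < j -> #|half_pairings m j| = 0) /\
  (forall a, m = a.*2 + j -> (a + j).+1 * #|half_pairings m j| = j.+1 * 'C(m, a)).
Proof.
elim: m j => [|m IH] j mN.
  rewrite half_pairings0; split; first by case: j => [|j].
  by move=> a; case: a => [|a]; case: j => // _; rewrite bin0.
have IH' i := IH i (ltnW mN).
rewrite (card_half_pairingsS mN); split=> [Hj|a Ea].
  rewrite (proj1 (IH' j.+1)); last by lia.
  by case: j Hj => // j Hj; rewrite (proj1 (IH' j)).
case: j Ea => [|j] Ea.
  case: a Ea => [|a] Ea; first by lia.
  have Em : m = a.*2 + 1 by lia.
  have := proj2 (IH' 1) a Em; rewrite add0n Em => H.
  have : a.+1 * 'C(a.*2 + 2, a.+1) = a.+1 * (2 * 'C(a.*2 + 1, a)).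
    rewrite -mul_bin_diag addn2 /= addn1.
    by rewrite mulnCA mul2n -doubleS -doubleMl; nia.
  move/eqP; rewrite eqn_pmul2l // => /eqP E.
  have -> : (a.*2 + 1).+1 = a.*2 + 2 by lia.
  by rewrite mul1n E -H; lia.
have Em : m = a.*2 + j by lia.
have H1 := proj2 (IH' j) a Em.
case: a Ea Em H1 => [|a] Ea Em H1.
  rewrite (proj1 (IH' j.+2)); last by lia.
  move: H1; rewrite !bin0 add0n => /eqP; rewrite eqn_pmul2l // => /eqP ->; lia.
have H2 := proj2 (IH' j.+2) a ltac:(lia).
have B := mul_bin_left m a.
have B2 : (m - a) = (a + j).+2 by lia.
rewrite B2 in B; rewrite binS.
set h1 := #|_| in H1 *; set h2 := #|_| in H2 *.
have P : 0 < (a.+1 + j).+1 by [].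
apply/eqP; rewrite -(eqn_pmul2l P); apply/eqP.
move: H1 H2 B; move: ('C(m, a.+1)) ('C(m, a)) h1 h2 => x y h1 h2; clear; nia.
Qed.

End Ballot.

Section PlanarCount.
Import boot.finset boot.fintype.
Local Open Scope set_scope.

Lemma planar_count_half_pairings m : planar_count m = #|half_pairings m m 0|.
Proof.
apply: eq_card => s; rewrite !inE; apply/andP/andP => -[].
  move=> /forallP H1 /forallP H2; split.
    apply/half_pairingP; split=> [i|i|i k ik].
    - by have := ltn_ord i; lia.
    - by have /andP[_ /eqP] := H1 i.
    - have /andP[-> ->] := implyP (forallP (H2 i) k) ik.
      by split=> //; apply/eqP; case/andP: (H1 k).
  rewrite /open_points cards_eq0; apply/eqP/setP => i; rewrite !inE.
  by case/andP: (H1 i) => /negbTE ->; rewrite andbF.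
move=> /half_pairingP[H1 H2 H3]; rewrite /open_points cards_eq0 => /eqP/setP O; split.
  apply/forallP => i; rewrite H2 eqxx andbT.
  by have := O i; rewrite !inE ltn_ord /= => ->.
by apply/forallP => i; apply/forallP => k; apply/implyP => /H3[-> ->].
Qed.

Lemma planar_count_even a : a.+1 * planar_count a.*2 = 'C(a.*2, a).
Proof.
rewrite planar_count_half_pairings; have := proj2 (ballot_number 0 (leqnn a.*2)) a.
by rewrite !addn0 mul1n; apply.
Qed.
End PlanarCount.

(** * Moments of the semicircle law *)

Local Open Scope classical_set_scope.
Local Open Scope ring_scope.

Section ContinuousCombinators.
Variable R : realType.
Implicit Types f g : R -> R.

Lemma continuous_mul f g :
  continuous f -> continuous g -> continuous (fun x => f x * g x).
Proof. by move=> cf cg x; apply: cvgM; [exact: cf|exact: cg]. Qed.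

Lemma continuous_sub f g :
  continuous f -> continuous g -> continuous (fun x => f x - g x).
Proof. by move=> cf cg x; apply: cvgB; [exact: cf|exact: cg]. Qed.

Lemma continuous_const (a : R) : continuous ((fun=> a) : R -> R).
Proof. by move=> x; exact: cvg_cst. Qed.

Lemma continuous_pow f n : continuous f -> continuous (fun x => f x ^+ n).
Proof.
by move=> cf x; apply: (@continuous_comp _ _ _ f (fun z => z ^+ n));
  [exact: cf|exact: exprn_continuous].
Qed.
End ContinuousCombinators.

Section Semicircle.
Variable R : realType.
Notation mu := (@lebesgue_measure R).

Lemma derivable_oo_LRcontinuousT (F : R -> R) (a b : R) :
  (forall x : R, derivable F x (1 : R)) -> derivable_oo_LRcontinuous F a b.
Proof.
move=> dF; have cF : continuous F.
  by move=> x; apply/differentiable_continuous/derivable1_diffP.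
by split=> [x _||]; [exact: dF|apply: cvg_at_right_filter; exact: cF|
  apply: cvg_at_left_filter; exact: cF].
Qed.

Lemma Rintegral_derive (F f : R -> R) (a b : R) : a < b -> continuous f ->
  (forall x : R, is_derive x (1 : R) F (f x)) ->
  \int[mu]_(x in `[a, b]) f x = F b - F a.
Proof.
move=> ab cf dF; rewrite /Rintegral (@continuous_FTC2 _ f F) //.
- exact: continuous_subspaceT.
- by apply: derivable_oo_LRcontinuousT => x; have [] := dF x.
- by move=> x _; rewrite derive1E; have [_ ->] := dF x.
Qed.

Definition sin2cos_integral m : R :=
  \int[mu]_(x in `[- (pi / 2), pi / 2]) (sin x ^+ m * cos x ^+ 2).

Let contsc m k : continuous (fun x : R => sin x ^+ m * cos x ^+ k).
Proof.
apply: continuous_mul; apply: continuous_pow; [exact: continuous_sin|exact: continuous_cos].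
Qed.

Let Npi2_lt_pi2 : - (pi / 2) < pi / 2 :> R.
Proof. by have := @pi_gt0 R; lra. Qed.

Let integrable_cont (f : R -> R) (a b : R) : continuous f -> mu.-integrable `[a, b] (EFin \o f).
Proof.
by move=> cf; apply: continuous_compact_integrable;
  [exact: segment_compact|exact: continuous_subspaceT].
Qed.

Lemma sin2cos_integral0 : sin2cos_integral 0 = pi / 2.
Proof.
pose F (x : R) := 2^-1 * (x + sin x * cos x).
have dF (x : R) : is_derive x (1 : R) F (sin x ^+ 0 * cos x ^+ 2).
  apply: is_derive_eq; rewrite expr0 mul1r /GRing.scale /=.
  by have := cos2Dsin2 x; lra.
rewrite /sin2cos_integral (Rintegral_derive Npi2_lt_pi2 (@contsc 0%N 2%N) dF) /F.
by rewrite cosN cos_pihalf; field.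
Qed.

Lemma sin2cos_integral1 : sin2cos_integral 1 = 0.
Proof.
pose F (x : R) := - 3^-1 * cos x ^+ 3.
have dF (x : R) : is_derive x (1 : R) F (sin x ^+ 1 * cos x ^+ 2).
  by apply: is_derive_eq; rewrite /GRing.scale /=; field.
rewrite /sin2cos_integral (Rintegral_derive Npi2_lt_pi2 (@contsc 1%N 2%N) dF) /F.
by rewrite cosN cos_pihalf; field.
Qed.

(** This integrates the derivative of sin^(m+1) cos^3, which vanishes at both
    ends of the interval. *)
Lemma sin2cos_integralSS m :
  (m + 4)%:R * sin2cos_integral m.+2 = (m + 1)%:R * sin2cos_integral m.
Proof.
pose F : R -> R := sin ^+ m.+1 * cos ^+ 3.
pose f (x : R) := (m + 1)%:R * (sin x ^+ m * cos x ^+ 2) - (m + 4)%:R * (sin x ^+ m.+2 * cos x ^+ 2).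
have dF (x : R) : is_derive x (1 : R) F (f x).
  apply: is_derive_eq; rewrite /GRing.scale /= /f !fctE.
  have E : cos x ^+ 2 = 1 - sin x ^+ 2 by have := cos2Dsin2 x; lra.
  rewrite !natrD !exprS.
  transitivity ((m%:R + 1) * sin x ^+ m * (cos x ^+ 2 * cos x ^+ 2)
    - 3 * (sin x ^+ 2 * sin x ^+ m) * cos x ^+ 2); last by rewrite {1}E; ring.
  ring.
have cf : continuous f.
  by apply: continuous_sub; apply: continuous_mul;
     [exact: continuous_const|exact: contsc|exact: continuous_const|exact: contsc].
have : \int[mu]_(x in `[- (pi / 2), pi / 2]) f x = 0.
  rewrite (Rintegral_derive Npi2_lt_pi2 cf dF) /F !fctE.
  by rewrite cosN cos_pihalf expr0n !mulr0 subrr.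
rewrite /f.
rewrite RintegralB //.
- rewrite !RintegralZl //; try (apply: integrable_cont; exact: contsc).
  by rewrite -!/(sin2cos_integral _) => /eqP; rewrite subr_eq0 => /eqP ->.
- apply: integrable_cont; apply: continuous_mul; [exact: continuous_const|exact: contsc].
- apply: integrable_cont; apply: continuous_mul; [exact: continuous_const|exact: contsc].
Qed.

Variable c : R.
Hypothesis c0 : 0 < c.
Let L : R := 2 * Num.sqrt c.

(** Substitute t = 2 sqrt(c) sin(theta). *)
Lemma semicircle_moment_trig m :
  semicircle_moment c m = 2 / pi * L ^+ m * sin2cos_integral m.
Proof.
have pi0 := @pi_gt0 R.
have L0 : 0 < L by rewrite mulr_gt0 // sqrtr_gt0.
have L2 : L ^+ 2 = 4 * c by rewrite exprMn sqr_sqrtr ?ltW //; ring.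
have dF (x : R) : is_derive x (1 : R) (fun x : R => L * sin x) (L * cos x).
  by apply: is_derive_eq.
have F' : derive1 (fun x : R => L * sin x) = (fun x : R => L * cos x).
  by apply/funext => x; rewrite derive1E; have [_ ->] := dF x.
have cF' : continuous (fun x : R => L * cos x).
  by apply: continuous_mul; [exact: continuous_const|exact: continuous_cos].
pose g (t : R) := t ^+ m / (2 * pi * c) * Num.sqrt (4 * c - t ^+ 2).
rewrite /semicircle_moment -/L /Rintegral.
have -> : L = L * sin (pi / 2) by rewrite sin_pihalf mulr1.
rewrite -mulrN -sinN.
have := @integration_by_substitution_increasing _ (fun x : R => L * sin x) g (- (pi / 2)) (pi / 2).
rewrite F' /= => ->; first last.
- apply: continuous_subspaceT; apply: continuous_mul.
    by apply: continuous_mul; [apply: continuous_pow => x; exact: cvg_id|exact: continuous_const].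
  move=> t; apply: (@continuous_comp _ _ _ (fun t : R => 4 * c - t ^+ 2) Num.sqrt).
    apply: continuous_sub; first exact: continuous_const.
    by apply: continuous_pow => x; exact: cvg_id.
  exact: sqrt_continuous.
- by apply: derivable_oo_LRcontinuousT => x; have [] := dF x.
- apply/cvg_ex; exists (L * cos (pi / 2)); apply: cvg_at_left_filter; exact: cF'.
- apply/cvg_ex; exists (L * cos (- (pi / 2))); apply: cvg_at_right_filter; exact: cF'.
- by move=> x _; exact: cF'.
- by move=> x y xi yi xy; rewrite ltr_pM2l // ltr_sin.
- exact: ltW.
rewrite -/(Rintegral _ _ _) sin_pihalf mulr1.
rewrite /sin2cos_integral -RintegralZl //; last by apply: integrable_cont; exact: contsc.
apply: eq_Rintegral => x; rewrite classical_sets.inE /= in_itv /= => xi.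
rewrite ?fctE /g /=.
have -> : 4 * c - (L * sin x) ^+ 2 = (L * cos x) ^+ 2.
  by rewrite (exprMn _ L (sin x)) (exprMn _ L (cos x)) L2; have := cos2Dsin2 x; nra.
rewrite sqrtr_sqr ger0_norm; last by apply: mulr_ge0; [exact: ltW|exact: cos_ge0_pihalf].
rewrite (exprMn _ L).
have -> : 2 * pi * c = 2^-1 * pi * L ^+ 2 by rewrite L2; field.
move: pi0 L0; clear; move: (pi : R) L => q l q0 l0.
by field; rewrite !gt_eqF.
Qed.

Lemma semicircle_moment0 : semicircle_moment c 0 = 1.
Proof.
rewrite semicircle_moment_trig sin2cos_integral0 expr0 mulr1 mulrA divfK ?divff //.
by rewrite gt_eqF // pi_gt0.
Qed.

Lemma semicircle_moment1 : semicircle_moment c 1 = 0.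
Proof. by rewrite semicircle_moment_trig sin2cos_integral1 mulr0. Qed.

Lemma semicircle_momentSS m :
  (m + 4)%:R * semicircle_moment c m.+2 = 4 * c * (m + 1)%:R * semicircle_moment c m.
Proof.
have L2 : L ^+ 2 = 4 * c by rewrite exprMn sqr_sqrtr ?ltW //; ring.
have Lm : L ^+ m.+2 = L ^+ m * L ^+ 2 by rewrite -exprD addn2.
rewrite !semicircle_moment_trig -L2 Lm.
transitivity (2 / pi * L ^+ m * L ^+ 2 * ((m + 4)%:R * sin2cos_integral m.+2)); first by ring.
rewrite sin2cos_integralSS; ring.
Qed.

Lemma semicircle_moment_odd m : odd m -> semicircle_moment c m = 0.
Proof.
move=> om; rewrite -(odd_double_half m) om add1n.
elim: (m./2) => [|k IH]; first exact: semicircle_moment1.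
have := semicircle_momentSS k.*2.+1; rewrite IH mulr0 => /eqP.
by rewrite mulf_eq0 pnatr_eq0 addn4 /= => /eqP.
Qed.

(** The Catalan numbers planar_count k.*2 satisfy, up to powers of c, the recurrence
    semicircle_momentSS. *)
Lemma semicircle_moment_even k :
  semicircle_moment c k.*2 = c ^+ k * (planar_count k.*2)%:R.
Proof.
elim: k => [|k IH].
  have := planar_count_even 0; rewrite mul1n bin0 => /= ->.
  by rewrite semicircle_moment0 expr0 mulr1.
have P1 := planar_count_even k; have P2 := planar_count_even k.+1.
have key : ((k.*2 + 4) * planar_count k.+1.*2 = 4 * (k.*2 + 1) * planar_count k.*2)%N.
  have B1 := mul_bin_diag k.*2.+2 k.
  have B2 : (k.+1 * 'C(k.*2.+1, k) = k.*2.+1 * 'C(k.*2, k))%N.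
    by rewrite -[in RHS]/(k.*2.+1.-1) mul_bin_down; congr (_ * _)%N; lia.
  have P : (0 < k.+1 * k.+1)%N by [].
  move: P1 P2 B1 B2; rewrite doubleS.
  move: ('C(k.*2.+2, k.+1)) ('C(k.*2.+1, k)) ('C(k.*2, k)) (planar_count k.*2) (planar_count k.*2.+2).
  move=> x y z u v E1 E2 E3 E4; apply/eqP; rewrite -(eqn_pmul2l P); apply/eqP.
  have -> : (k.+1 * k.+1 * ((k.*2 + 4) * v) = 2 * k.+1 * k.+1 * (k.+2 * v))%N by nia.
  have -> : (k.+1 * k.+1 * (4 * (k.*2 + 1) * u) = 4 * k.+1 * k.*2.+1 * (k.+1 * u))%N by nia.
  rewrite E2 E1; have -> : (2 * k.+1 * k.+1 * x = 2 * k.+1 * (k.+1 * x))%N by nia.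
  rewrite -E3 /=; have -> : (2 * k.+1 * (k.*2.+2 * y) = 4 * k.+1 * (k.+1 * y))%N by nia.
  by rewrite E4; nia.
have := semicircle_momentSS k.*2; rewrite IH doubleS => H.
apply: (@mulfI _ (k.*2 + 4)%:R); first by rewrite pnatr_eq0 addn4.
rewrite H [RHS]mulrCA -natrM -doubleS key !natrM exprS; ring.
Qed.
End Semicircle.

(** * Change of variables under a density *)

Lemma sub_max0 (R : realDomainType) (x : R) : Num.max x 0 - Num.max (- x) 0 = x.
Proof.
case: (boolP (0 <= x)) => [x0|]; first by rewrite (max_l x0) max_r ?subr0 // oppr_le0.
by rewrite -ltNge => x0; rewrite (max_r (ltW x0)) max_l ?sub0r ?opprK // oppr_ge0 ltW.
Qed.

Lemma Rintegral_probability1 {disp} {T : measurableType disp} {R : realType}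
  (P : probability T R) : \int[P]_w (1 : R) = 1.
Proof.
rewrite Rintegral_cst // mul1r -[RHS]/(fine (1%E : \bar R)); congr fine.
exact: probability_setT.
Qed.

(** The hypothesis density is the change of variables for indicator functions; it
    extends to simple functions by linearity and to nonnegative functions by
    monotone convergence.  The constant C makes room for a weight Y that is
    independent of Z, the weight Y for a probability density, and the two variables
    Z and Z' for the law of a random variable. *)
Section NonnegativeDensity.
Context {d d' d'' : measure_display} {T : measurableType d} {T' : measurableType d''}.
Context {E : measurableType d'} {R : realType}.
Variables (P : {measure set T -> \bar R}) (Q : {measure set T' -> \bar R}).
Variables (Z : T -> E) (Y : T -> R) (Z' : T' -> E) (C : R).
Hypotheses (mZ : measurable_fun setT Z) (mY : measurable_fun setT Y).
Hypotheses (mZ' : measurable_fun setT Z') (Y0 : forall w, 0 <= Y w).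
Hypothesis density : forall A, measurable A ->
  (\int[P]_w (\1_A (Z w) * Y w)%:E = C%:E * Q (Z' @^-1` A))%E.

Local Open Scope ereal_scope.

Import HBNNSimple.

Lemma integral_nnsfun_density (h : {nnsfun E >-> R}) :
  \int[P]_w (h (Z w) * Y w)%:E = C%:E * \int[Q]_w (h (Z' w))%:E.
Proof.
have hE x : h x = (\sum_(y \in range h) y * \1_(h @^-1` [set y]) x)%R by rewrite -fimfunE.
have mA y : measurable (h @^-1` [set y]) by [].
have ms y : measurable (Z' @^-1` (h @^-1` [set y])).
  by rewrite -[X in measurable X]setTI; exact: mZ'.
have mi y : measurable_fun setT (fun w => \1_(h @^-1` [set y]) (Z w) : R).
  by apply: measurableT_comp => //; exact: measurable_indic.
have mi' y : measurable_fun setT (fun w => \1_(h @^-1` [set y]) (Z' w) : R).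
  by apply: measurableT_comp => //; exact: measurable_indic.
have nn y x : (0 <= y * \1_(h @^-1` [set y]) x)%R.
  by have := @nnfun_muleindic_ge0 _ _ R h y x; rewrite -EFinM lee_fin.
have -> : \int[Q]_w (h (Z' w))%:E = \sum_(y \in range h) (y%:E * Q (Z' @^-1` (h @^-1` [set y]))).
  under eq_integral do rewrite hE -fsumEFin //.
  rewrite ge0_integral_fsum //.
  - apply: eq_fsbigr => y; rewrite classical_sets.inE => -[x _ yE].
    under eq_integral do rewrite EFinM.
    rewrite ge0_integralZl_EFin //; last by rewrite -yE.
    + congr (_ * _).
      have -> : (fun w => (\1_(h @^-1` [set y]) (Z' w))%:E) =
         (fun w => (\1_(Z' @^-1` (h @^-1` [set y])) w)%:E :> \bar R) by [].
      by rewrite integral_indic // setIT.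
    + by apply/measurable_EFinP.
  - by move=> y; apply/measurable_EFinP; apply: measurable_funM.
  - by move=> y w _; rewrite lee_fin nn.
rewrite ge0_mule_fsumr; last first.
  move=> y; have [y0|y0] := leP 0%R y; first by rewrite mule_ge0.
  by rewrite preimage_nnfun0 // preimage_set0 measure0 mule0.
under eq_integral do rewrite hE mulr_fsuml // -fsumEFin //.
rewrite ge0_integral_fsum //.
- apply: eq_fsbigr => y; rewrite classical_sets.inE => -[x _ yE].
  under eq_integral do rewrite -mulrA EFinM.
  rewrite ge0_integralZl_EFin //; last by rewrite -yE.
  + by rewrite density // muleCA.
  + by move=> w _; rewrite lee_fin mulr_ge0.
  + by apply/measurable_EFinP; apply: measurable_funM.
- by move=> y; apply/measurable_EFinP; apply: measurable_funM => //; apply: measurable_funM.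
- by move=> y w _; rewrite lee_fin mulr_ge0.
Qed.

Lemma ge0_integral_density (g : E -> R) : measurable_fun setT g ->
  (forall x, (0 <= g x)%R) ->
  \int[P]_w (g (Z w) * Y w)%:E = C%:E * \int[Q]_w (g (Z' w))%:E.
Proof.
move=> mg g0.
have meg : measurable_fun setT (EFin \o g) by apply/measurable_EFinP.
pose h := nnsfun_approx measurableT meg.
have hcv x : (h n x)%:E @[n --> \oo] --> (g x)%:E.
  by apply: (cvg_nnsfun_approx measurableT meg) => // z _; rewrite lee_fin.
have mh n : measurable_fun setT (fun w => h n (Z w)) by apply: measurableT_comp.
have mh' n : measurable_fun setT (fun w => h n (Z' w)) by apply: measurableT_comp.
have hnd x : {homo (fun n => h n x) : m n / (m <= n)%N >-> (m <= n)%R}.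
  by move=> m n mn; exact/lefP/(nd_nnsfun_approx measurableT meg).
have cv1 : \int[P]_w (h n (Z w) * Y w)%:E @[n --> \oo] --> \int[P]_w (g (Z w) * Y w)%:E.
  have -> : (fun w => (g (Z w) * Y w)%:E) = (fun w => limn (fun n => (h n (Z w) * Y w)%:E)).
    apply/funext => w; apply/esym/cvg_lim => //.
    under eq_fun do rewrite EFinM.
    by rewrite EFinM; apply: cvgeZr => //; exact: hcv.
  apply: cvg_monotone_convergence => //.
  - by move=> n; apply/measurable_EFinP; apply: measurable_funM.
  - by move=> n w _; rewrite lee_fin mulr_ge0.
  - by move=> w _ m n mn; rewrite lee_fin ler_wpM2r // hnd.
have cv2 : \int[Q]_w (h n (Z' w))%:E @[n --> \oo] --> \int[Q]_w (g (Z' w))%:E.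
  have -> : (fun w => (g (Z' w))%:E) = (fun w => limn (fun n => (h n (Z' w))%:E)).
    by apply/funext => w; apply/esym/cvg_lim => //; exact: hcv.
  apply: cvg_monotone_convergence => //.
  - by move=> n; apply/measurable_EFinP; exact: mh'.
  - by move=> n w _; rewrite lee_fin; apply: fun_ge0.
  - by move=> w _ m n mn; rewrite lee_fin hnd.
have cv3 := cvgeZl (y := C%:E) isT cv2.
have E1 : (fun n => \int[P]_w (h n (Z w) * Y w)%:E) = (fun n => C%:E * \int[Q]_w (h n (Z' w))%:E).
  by apply/funext => n; exact: integral_nnsfun_density.
rewrite E1 in cv1.
exact: (cvg_unique _ cv1 cv3).
Qed.
End NonnegativeDensity.

Section DensityTransfer.
Context {d d' d'' : measure_display} {T : measurableType d} {T' : measurableType d''}.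
Context {E : measurableType d'} {R : realType}.
Variables (P : {measure set T -> \bar R}) (Q : {measure set T' -> \bar R}).
Variables (Z : T -> E) (Y : T -> R) (Z' : T' -> E).
Hypotheses (mZ : measurable_fun setT Z) (mY : measurable_fun setT Y).
Hypotheses (mZ' : measurable_fun setT Z') (Y0 : forall w, 0 <= Y w).
Hypothesis density : forall A, measurable A ->
  (\int[P]_w (\1_A (Z w) * Y w)%:E = Q (Z' @^-1` A))%E.

Let ge0_transfer (g : E -> R) : measurable_fun setT g -> (forall x, (0 <= g x)%R) ->
  (\int[P]_w (g (Z w) * Y w)%:E = \int[Q]_w (g (Z' w))%:E)%E.
Proof.
move=> mg g0; rewrite (ge0_integral_density (Q := Q) mZ mY mZ' Y0 (C := 1)) ?mul1e //.
by move=> A mA; rewrite mul1e density.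
Qed.

Lemma integrable_density (g : E -> R) : measurable_fun setT g ->
  P.-integrable setT (fun w => (g (Z w) * Y w)%:E) <->
  Q.-integrable setT (fun w => (g (Z' w))%:E).
Proof.
move=> mg; have E1 : (\int[P]_w `|(g (Z w) * Y w)%:E| = \int[Q]_w `|(g (Z' w))%:E|)%E.
  under eq_integral do rewrite abse_EFin normrM (ger0_norm (Y0 _)).
  rewrite (ge0_transfer (g := fun x => `|g x|)) //.
  exact: measurableT_comp.
have m1 : measurable_fun setT (fun w => (g (Z w) * Y w)%:E).
  by apply/measurable_EFinP; apply: measurable_funM => //; apply: measurableT_comp.
have m2 : measurable_fun setT (fun w => (g (Z' w))%:E).
  by apply/measurable_EFinP; apply: measurableT_comp.
by split=> /integrableP[_ H]; apply/integrableP; split=> //; [rewrite -E1|rewrite E1].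
Qed.

(** A function without a sign is the difference of its positive and negative
    parts. *)
Lemma Rintegral_density (g : E -> R) : measurable_fun setT g ->
  Q.-integrable setT (fun w => (g (Z' w))%:E) ->
  \int[P]_w (g (Z w) * Y w) = \int[Q]_w g (Z' w).
Proof.
move=> mg ig.
pose u (b : bool) x := Num.max (if b then g x else - g x) 0.
have mu b : measurable_fun setT (u b).
  by apply: measurable_maxr => //; case: b => //; apply: measurableT_comp.
have u0 b x : 0 <= u b x by rewrite le_max lexx orbT.
have gE x : g x = u true x - u false x by rewrite /u sub_max0.
have iu b : Q.-integrable setT (fun w => (u b (Z' w))%:E).
  apply: (le_integrable measurableT _ _ ig) => /=.
    by apply/measurable_EFinP; apply: measurableT_comp.
  move=> w _; rewrite lee_fin (ger0_norm (u0 b _)) /u ge_max normr_ge0 andbT.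
  by case: b; rewrite ?ler_norm // -normrN ler_norm.
have iuP b := (integrable_density (mu b)).2 (iu b).
transitivity (\int[P]_w (u true (Z w) * Y w - u false (Z w) * Y w)).
  by apply: eq_Rintegral => w _; rewrite gE mulrBl.
transitivity (\int[Q]_w (u true (Z' w) - u false (Z' w))); last first.
  by apply: eq_Rintegral => w _; rewrite -gE.
have tr b : \int[P]_w (u b (Z w) * Y w) = \int[Q]_w u b (Z' w).
  by rewrite /Rintegral ge0_transfer.
rewrite (RintegralB measurableT (iuP true) (iuP false)).
by rewrite (RintegralB measurableT (iu true) (iu false)) !tr.
Qed.
End DensityTransfer.

(** * Expectations of products of independent variables *)

Section IndependentProducts.
Context {d d' : measure_display} {T : measurableType d} {E : measurableType d'} {R : realType}.
Variable P : probability T R.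
Variables (I : finType) (Z : I -> T -> E).
Hypothesis mZ : forall i, measurable_fun setT (Z i).
Hypothesis indZ : forall A : I -> set E, (forall i, measurable (A i)) ->
  P (\bigcap_i (Z i @^-1` A i)) = (\prod_i P (Z i @^-1` A i))%E.

Let measurable_pre i A : measurable A -> measurable (Z i @^-1` A).
Proof. by move=> mA; rewrite -[X in measurable X]setTI; exact: mZ. Qed.

Let prodT (f : I -> E -> R) w := \prod_i f i (Z i w).

Let measurable_prodT f : (forall i, measurable_fun setT (f i)) -> measurable_fun setT (prodT f).
Proof. by move=> mf; apply: measurable_prod => i _; apply: measurableT_comp. Qed.

Let integral_indic_comp i A : measurable A ->
  (\int[P]_w (\1_A (Z i w))%:E = P (Z i @^-1` A))%E.
Proof.
move=> mA.
have -> : (fun w => (\1_A (Z i w))%:E) = (fun w => (\1_(Z i @^-1` A) w)%:E :> \bar R) by [].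
by rewrite integral_indic ?setIT //; exact: measurable_pre.
Qed.

(** Independence is the case of indicator functions.  One index at a time, an
    indicator function is replaced by f i: the product of the other factors is a
    weight for which the change of variables holds on indicator functions by
    induction. *)
Lemma independent_prod_ge0 (f : I -> E -> R) (M : I -> R) :
  (forall i, measurable_fun setT (f i)) -> (forall i x, 0 <= f i x) ->
  (forall i, \int[P]_w (f i (Z i w))%:E = (M i)%:E)%E ->
  (\int[P]_w (prodT f w)%:E = (\prod_i M i)%:E)%E.
Proof.
move=> mf f0 fM.
(* s lists the indices whose function need not be an indicator function *)
have [s sP] : exists s : seq I, forall i, i \notin s -> exists2 A, measurable A & f i = \1_A.
  by exists (enum I) => i; rewrite mem_enum.
elim: s f M mf f0 fM sP => [|i s IH] f M mf f0 fM sP.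
  have /choice[A AP] : forall i, exists A, measurable A /\ f i = \1_A.
    by move=> i; have [A mA fA] := sP i isT; exists A.
  have -> : (fun w => (prodT f w)%:E) = (fun w => (\1_(\bigcap_i (Z i @^-1` A i)) w)%:E).
    apply/funext => w; rewrite /prodT; congr _%:E.
    rewrite indicE; case: (pselect ((\bigcap_i (Z i @^-1` A i)) w)) => [H|H].
      by rewrite mem_set // big1 // => i _; rewrite (AP i).2 indicE mem_set //; exact: H.
    rewrite memNset //.
    have [j nj] : exists j, ~ A j (Z j w).
      by apply: contrapT => /forallNP H'; apply: H => j _; apply: contrapT; exact: H'.
    by rewrite (bigD1 j) //= (AP j).2 indicE memNset // mul0r.
  rewrite integral_indic //; last first.
    by apply: fin_bigcap_measurable => // i _; apply: measurable_pre; exact: (AP i).1.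
  rewrite setIT; apply: etrans (indZ _) _; first by move=> i; exact: (AP i).1.
  rewrite -prodEFin; apply: eq_bigr => i _.
  by rewrite -fM (AP i).2 integral_indic_comp //; exact: (AP i).1.
pose Y w := \prod_(j | j != i) f j (Z j w).
pose C := \prod_(j | j != i) M j.
have M0 j : 0 <= M j.
  by rewrite -lee_fin -fM; apply: integral_ge0 => w _; rewrite lee_fin.
have mY : measurable_fun setT Y.
  rewrite /Y; under eq_fun do rewrite big_mkcond /=.
  apply: measurable_prod => j _; case: (j != i) => //; exact: measurableT_comp.
have key A : measurable A ->
    (\int[P]_w (\1_A (Z i w) * Y w)%:E = C%:E * P (Z i @^-1` A))%E.
  move=> mA; pose f' j := if j == i then \1_A else f j.
  pose M' j := if j == i then fine (P (Z i @^-1` A)) else M j.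
  have f'i : f' i = \1_A by rewrite /f' eqxx.
  have -> : (fun w => (\1_A (Z i w) * Y w)%:E) = (fun w => (prodT f' w)%:E).
    apply/funext => w; rewrite /prodT (bigD1 i) //= f'i; congr (_ * _)%:E.
    by apply: eq_bigr => j /negbTE ji; rewrite /f' ji.
  rewrite (IH f' M').
  - rewrite (bigD1 i) //= /M' eqxx mulrC EFinM fineK ?probability_fin_num //.
      congr (_ * _)%E; congr _%:E; apply: eq_bigr => j /negbTE -> //.
    by rewrite fin_num_measure //; exact: measurable_pre.
  - move=> j; rewrite /f'; case: eqP => // _; exact: measurable_indic.
  - by move=> j x; rewrite /f'; case: eqP.
  - move=> j; rewrite /f' /M'; case: eqP => [->|_]; last exact: fM.
    rewrite integral_indic_comp // fineK //.
    by rewrite fin_num_measure //; exact: measurable_pre.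
  - move=> j js; rewrite /f'; case: eqP => [_|/eqP ji]; first by exists A.
    by apply: sP; rewrite inE negb_or ji.
have C0 : 0 <= C by apply: prodr_ge0.
have Y0 w : 0 <= Y w by apply: prodr_ge0.
have := @ge0_integral_density _ _ _ T T E R P P (Z i) Y (Z i) C (mZ i) mY (mZ i) Y0 key (f i) (mf i) (f0 i).
rewrite fM -EFinM [in X in _ = X -> _]mulrC => E1.
rewrite (bigD1 i) //= -E1; apply: eq_integral => w _.
by rewrite /prodT (bigD1 i).
Qed.

Lemma independent_prod_integrable (f : I -> E -> R) :
  (forall i, measurable_fun setT (f i)) ->
  (forall i, P.-integrable setT (fun w => (f i (Z i w))%:E)) ->
  P.-integrable setT (fun w => (prodT f w)%:E).
Proof.
move=> mf intf; apply/integrableP; split.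
  by apply/measurable_EFinP; exact: measurable_prodT.
pose g i x := `|f i x|.
have -> : (fun w => `|(prodT f w)%:E|)%E = (fun w => (prodT g w)%:E).
  by apply/funext => w; rewrite abse_EFin /prodT normr_prod.
rewrite (@independent_prod_ge0 g (fun i => fine (\int[P]_w (g i (Z i w))%:E)%E)) ?ltry //.
- by move=> i; apply: measurableT_comp.
- by move=> i x; exact: normr_ge0.
- move=> i; rewrite fineK //.
apply: integrable_fin_num => //.
have := integrable_abse (intf i); by [].
Qed.

(** One index at a time, f i is split into its positive and negative parts; the
    nonnegative case is then independent_prod_ge0. *)
Lemma independent_prod (f : I -> E -> R) :
  (forall i, measurable_fun setT (f i)) ->
  (forall i, P.-integrable setT (fun w => (f i (Z i w))%:E)) ->
  \int[P]_w prodT f w = \prod_i \int[P]_w f i (Z i w).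
Proof.
move=> mf intf.
(* s lists the indices whose function may take negative values *)
have [s sP] : exists s : seq I, forall i, i \notin s -> forall x, 0 <= f i x.
  by exists (enum I) => i; rewrite mem_enum.
elim: s f mf intf sP => [|i s IH] f mf intf sP.
  rewrite /Rintegral (@independent_prod_ge0 f (fun i => fine (\int[P]_w (f i (Z i w))%:E)%E)) //.
    by move=> i x; apply: sP.
  by move=> i; rewrite fineK //; apply: integrable_fin_num.
pose u (b : bool) j x := if j == i then Num.max (if b then f i x else - f i x) 0 else f j x.
have mu b j : measurable_fun setT (u b j).
  rewrite /u; case: (j == i) => //; apply: measurable_maxr => //.
  by case: b => //; apply: measurableT_comp.
have intu b j : P.-integrable setT (fun w => (u b j (Z j w))%:E).
  rewrite /u; have [->|_] := eqVneq j i; last exact: intf.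
  apply: (le_integrable measurableT _ _ (intf i)) => /=.
    apply/measurable_EFinP; apply: measurable_maxr => //.
    by case: b; do ?[apply: measurableT_comp => //].
  move=> w _; rewrite lee_fin; case: b; rewrite ger0_norm ?le_max ?lexx ?orbT // ge_max normr_ge0 andbT.
    exact: ler_norm.
  by rewrite -normrN; exact: ler_norm.
have IHu b := IH (u b) (mu b) (intu b).
have split_f x : f i x = u true i x - u false i x by rewrite /u eqxx sub_max0.
have other b j : j != i -> u b j = f j.
  by move=> /negbTE ji; apply/funext => x; rewrite /u ji.
have prodD1 g w : prodT g w = g i (Z i w) * \prod_(j | j != i) g j (Z j w).
  by rewrite /prodT (bigD1 i).
have otherT b w : \prod_(j | j != i) u b j (Z j w) = \prod_(j | j != i) f j (Z j w).
  by apply: eq_bigr => j ji; rewrite other.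
have -> : prodT f = (fun w => prodT (u true) w - prodT (u false) w).
  by apply/funext => w; rewrite !prodD1 !otherT -mulrBl -split_f.
have us b j : j \notin s -> forall x, 0 <= u b j x.
  move=> js x; rewrite /u; case: eqP => [_|/eqP ji]; first by rewrite le_max lexx orbT.
  by apply: sP; rewrite inE negb_or ji.
have iT b := independent_prod_integrable (mu b) (intu b).
rewrite (RintegralB measurableT (iT true) (iT false)) !IHu; try exact: us.
have -> : \prod_j \int[P]_w f j (Z j w) =
    \int[P]_w f i (Z i w) * \prod_(j | j != i) \int[P]_w f j (Z j w).
  by rewrite (bigD1 i).
have intuD b : \prod_j \int[P]_w u b j (Z j w) =
    \int[P]_w u b i (Z i w) * \prod_(j | j != i) \int[P]_w f j (Z j w).
  by rewrite (bigD1 i) //=; congr (_ * _); apply: eq_bigr => j ji; rewrite other.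
have -> : \int[P]_w f i (Z i w) = \int[P]_w u true i (Z i w) - \int[P]_w u false i (Z i w).
  by rewrite -(RintegralB measurableT (intu true i) (intu false i)); apply: eq_Rintegral => w _.
by rewrite !intuD mulrBl.
Qed.

End IndependentProducts.

(** * Gaussian moments *)

Section GaussMoments.
Variable R : realType.
Notation mu := (@lebesgue_measure R).

Definition gauss_bound n : R := 2 ^+ n.+1 * (n.+1)`!%:R.

(** Half of the exponent absorbs the power: 1 + y^(n+1) / (n+1)! <= exp y with
    y = x^2 / 2 bounds |x|^n exp (- y). *)
Lemma pow_gauss_fun_le n (x : R) :
  `|x ^+ n * gauss_fun x| <= gauss_bound n * expR (- (x ^+ 2 / 2)).
Proof.
have F0 : 0 < (n.+1)`!%:R :> R by rewrite ltr0n fact_gt0.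
have F1 : 1 <= (n.+1)`!%:R :> R by rewrite ler1n fact_gt0.
have P1 : 1 <= 2 ^+ n.+1 :> R by apply: exprn_ege1; lra.
have y0 : 0 <= x ^+ 2 / 2 :> R by rewrite divr_ge0 // sqr_ge0.
rewrite normrM (ger0_norm (gauss_fun_ge0 _)) normrX /gauss_fun.
have -> : - x ^+ 2 = - (x ^+ 2 / 2) + - (x ^+ 2 / 2) by field.
rewrite expRD mulrA ler_wpM2r ?expR_ge0 // expRN ler_pdivrMr ?expR_gt0 //.
have H := expR_ge1Dxn n y0.
apply: (le_trans (y := gauss_bound n * (1 + (x ^+ 2 / 2) ^+ n.+1 / (n.+1)`!%:R))); last first.
  by rewrite ler_wpM2l // /gauss_bound mulr_ge0 ?exprn_ge0 // ltW.
rewrite /gauss_bound mulrDr mulr1 expr_div_n.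
have -> : 2 ^+ n.+1 * (n.+1)`!%:R * (x ^+ 2 ^+ n.+1 / 2 ^+ n.+1 / (n.+1)`!%:R) = `|x| ^+ 2 ^+ n.+1.
  by rewrite real_normK ?num_real //; field; rewrite !gt_eqF // exprn_gt0.
rewrite -exprM mul2n.
have [x1|x1] := leP `|x| 1.
  apply: (@le_trans _ _ 1); first by rewrite exprn_ile1.
  by rewrite -[leLHS]addr0 lerD ?exprn_ge0 // mulr_ege1.
apply: (@le_trans _ _ (`|x| ^+ n.+1.*2)); last by rewrite lerDr mulr_ge0 ?exprn_ge0 // ltW.
by apply: ler_weXn2l; [exact: ltW|lia].
Qed.

Let continuous_pow_gauss n : continuous (fun x : R => x ^+ n * gauss_fun x).
Proof.
apply: continuous_mul; last exact: continuous_gauss_fun.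
by apply: continuous_pow => x; exact: cvg_id.
Qed.

Let measurable_pow_gauss n : measurable_fun setT ((fun x => x ^+ n * gauss_fun x) : R -> R).
Proof. by apply: continuous_measurable_fun; exact: continuous_pow_gauss. Qed.

Lemma integrable_pow_gauss n :
  mu.-integrable setT (fun x => (x ^+ n * gauss_fun x)%:E).
Proof.
have : mu.-integrable setT (fun x => (gauss_bound n / normal_peak 1)%:E * (normal_pdf 0 1 x)%:E)%E.
  by apply: integrableZl => //; exact: integrable_normal_pdf.
apply: le_integrable => //; first by apply/measurable_EFinP; exact: measurable_pow_gauss.
move=> x _; rewrite -EFinM lee_fin.
have p0 : 0 < normal_peak 1 :> R by exact: normal_peak_gt0.
apply: (le_trans (pow_gauss_fun_le n x)); apply: le_trans (ler_norm _).
rewrite normal_pdfE // /normal_fun subr0 expr1n.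
by rewrite mulrA divfK ?gt_eqF // mulNr.
Qed.

(** The fundamental theorem of calculus on [-(n+1), n+1], then dominated
    convergence. *)
Lemma Rintegral_boundary0 (F f : R -> R) :
  (forall x : R, is_derive x (1 : R) F (f x)) -> continuous f ->
  mu.-integrable setT (fun x => (f x)%:E) ->
  F n.+1%:R @[n --> \oo] --> (0 : R) -> F (- n.+1%:R) @[n --> \oo] --> (0 : R) ->
  \int[mu]_x f x = 0.
Proof.
move=> dF cf intf F1 F2.
pose I n := `[- n.+1%:R, n.+1%:R]%classic : set R.
have mf : measurable_fun setT f by case/integrableP: intf => /measurable_EFinP.
have [] := @dominated_convergence _ _ _ mu setT measurableT
  (fun n => ((fun x => (f x)%:E) \_ (I n))) (fun x => (f x)%:E) (fun x => `|(f x)%:E|%E).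
- move=> n; have mI : measurable (I n) by exact: measurable_itv.
  apply/(measurable_restrictT _ mI).
  by apply: measurable_funTS; apply/measurable_EFinP.
- exact/measurable_EFinP.
- apply/aeW => x _; apply: cvg_near_cst; near=> n.
  suff xI : I n x by rewrite /patch (mem_set xI).
  rewrite /I /= in_itv /= -ler_norml.
  near: n; exists (Num.truncn `|x|) => // n /= ln.
  by apply/ltW/(lt_le_trans (truncnS_gt `|x|)); rewrite ler_nat.
- exact: integrable_abse.
- by apply/aeW => x n _; rewrite /patch; case: ifP => //; rewrite abse0 abse_ge0.
move=> _ _ cv.
have eqn n : (\int[mu]_x ((fun x => (f x)%:E) \_ (I n)) x = (F n.+1%:R - F (- n.+1%:R))%:E)%E.
  rewrite -integral_mkcond (@continuous_FTC2 _ f F) //.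
  - by rewrite gtrN // ltr0n.
  - exact: continuous_subspaceT.
  - by apply: derivable_oo_LRcontinuousT => x; have [] := dF x.
  - by move=> x _; rewrite derive1E; have [_ ->] := dF x.
have cv2 : (\int[mu]_x ((fun x => (f x)%:E) \_ (I n)) x)%E @[n --> \oo] --> (0%:E : \bar R).
  rewrite (_ : (fun n => _) = (fun n => (F n.+1%:R - F (- n.+1%:R))%:E)); last exact/funext.
  by apply: cvg_EFin; [exact: nearW|rewrite -[X in _ --> X]subr0; exact: cvgB].
by rewrite /Rintegral (cvg_unique _ cv cv2).
Unshelve. all: by end_near. Qed.

Lemma pow_gauss_cvg0 n (s : bool) :
  (fun x : R => x ^+ n * gauss_fun x) (if s then - k.+1%:R else k.+1%:R) @[k --> \oo] --> (0 : R).
Proof.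
apply/norm_cvg0P.
apply: (@squeeze_cvgr _ _ _ _ (fun=> 0) (fun k => gauss_bound n.+1 * harmonic k)).
- apply: nearW => k; rewrite normr_ge0 /=.
  have : `|if s then - k.+1%:R else k.+1%:R| = k.+1%:R :> R.
    by case: s; rewrite ?normrN normr_nat.
  rewrite /harmonic /=; move: (if s then - k.+1%:R else k.+1%:R) => x xk.
  rewrite ler_pdivlMr ?ltr0n // -xk mulrC -normrM mulrA -exprS.
  apply: (le_trans (pow_gauss_fun_le n.+1 x)).
  rewrite -[leRHS]mulr1 ler_wpM2l //; first by rewrite /gauss_bound mulr_ge0 ?exprn_ge0 ?ler0n.
  by rewrite -expR0 ler_expR oppr_le0 divr_ge0 // sqr_ge0.
- exact: cvg_cst.
- rewrite -[X in _ --> X](mulr0 (gauss_bound n.+1)).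
  by apply: cvgM; [exact: cvg_cst|exact: cvg_harmonic].
Qed.

Lemma is_derive_gauss (x : R) : is_derive x (1 : R) gauss_fun (- 2 * x * gauss_fun x).
Proof.
rewrite /gauss_fun; apply: is_derive_eq.
by rewrite /GRing.scale /=; ring.
Qed.

Lemma gauss_integral1 : \int[mu]_x (x ^+ 1 * gauss_fun x) = 0.
Proof.
pose F := (fun x : R => - 2^-1 * gauss_fun x).
have dF (x : R) : is_derive x (1 : R) F (x ^+ 1 * gauss_fun x).
  have := is_derive_gauss x => dg; apply: is_derive_eq.
  by rewrite /GRing.scale /=; field.
have F0 (s : bool) : F (if s then - k.+1%:R else k.+1%:R) @[k --> \oo] --> (0 : R).
  rewrite -[X in _ --> X](mulr0 (- 2^-1)); apply: cvgM; first exact: cvg_cst.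
  have := pow_gauss_cvg0 0 s; by under eq_fun do rewrite expr0 mul1r.
apply: (@Rintegral_boundary0 F) => //.
- exact: integrable_pow_gauss.
- exact: (F0 false).
- exact: (F0 true).
Qed.

(** This integrates the derivative of x^(n+1) exp (- x^2). *)
Lemma gauss_integralSS n :
  \int[mu]_x (x ^+ n.+2 * gauss_fun x) = (n.+1)%:R / 2 * \int[mu]_x (x ^+ n * gauss_fun x).
Proof.
pose F : R -> R := (fun x => x) ^+ n.+1 * gauss_fun.
pose f (x : R) := n.+1%:R * (x ^+ n * gauss_fun x) - 2 * (x ^+ n.+2 * gauss_fun x).
have dF (x : R) : is_derive x (1 : R) F (f x).
  have := is_derive_gauss x => dg; apply: is_derive_eq.
  by rewrite /GRing.scale /= /f !fctE !exprS; ring.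
have cf : continuous f.
  by apply: continuous_sub; apply: continuous_mul; do ?[exact: continuous_const]; exact: continuous_pow_gauss.
have ig k (a : R) : mu.-integrable setT (fun x => (a * (x ^+ k * gauss_fun x))%:E).
  have := integrableZl measurableT a (integrable_pow_gauss k).
  by apply: eq_integrable => // x _; rewrite EFinM.
have FE : F = (fun x => x ^+ n.+1 * gauss_fun x) by apply/funext => x; rewrite /F !fctE.
have : \int[mu]_x f x = 0.
  apply: (@Rintegral_boundary0 F) => //.
  - have := integrableB measurableT (ig n n.+1%:R) (ig n.+2 2).
    by apply: eq_integrable => // x _; rewrite EFinB.
  - by rewrite FE; exact: (pow_gauss_cvg0 n.+1 false).
  - by rewrite FE; exact: (pow_gauss_cvg0 n.+1 true).
rewrite /f (RintegralB measurableT (ig n n.+1%:R) (ig n.+2 2)).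
rewrite !RintegralZl //; try exact: integrable_pow_gauss.
by move=> /eqP; rewrite subr_eq0 => /eqP H; rewrite mulrAC H; field.
Qed.

End GaussMoments.

Section NormalMoments.
Variable R : realType.
Notation mu := (@lebesgue_measure R).
Notation sd := (Num.sqrt 2^-1 : R).
Notation nu := (normal_prob 0 sd).

(** The law of the real part and of the imaginary part of a standard complex
    Gaussian variable has variance 1/2, and its density is proportional to
    exp (- x^2). *)
Definition half_normal_moment n : R := \int[nu]_x x ^+ n.

Let sd2 : sd ^+ 2 *+ 2 = 1.
Proof. by rewrite sqr_sqrtr ?invr_ge0 // -mulr_natr mulVf. Qed.

Let sd0 : sd != 0.
Proof. by rewrite gt_eqF // sqrtr_gt0 invr_gt0. Qed.

Let peak := (normal_peak sd : R).

Let pdfE x : normal_pdf 0 sd x = peak * gauss_fun x.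
Proof. by rewrite normal_pdfE // /normal_fun subr0 sd2 divr1. Qed.

Let density_nu (A : set R) : measurable A ->
  (\int[mu]_x (\1_A (id x) * normal_pdf 0 sd x)%:E = nu (id @^-1` A))%E.
Proof.
move=> mA; rewrite /= /normal_prob [RHS]integral_mkcond; apply: eq_integral => x _.
by rewrite /patch indicE preimage_id; case: (x \in A); rewrite ?mul1r ?mul0r.
Qed.

Let measurable_pow n : measurable_fun setT ((fun x => x ^+ n) : R -> R).
Proof. by apply: measurable_funX. Qed.

Let integrable_pow_pdf n :
  mu.-integrable setT (fun x => (id x ^+ n * normal_pdf 0 sd x)%:E).
Proof.
have := integrableZl measurableT peak (integrable_pow_gauss R n).
by apply: eq_integrable => // x _; rewrite pdfE -EFinM mulrCA.
Qed.

Lemma integrable_half_normal n : nu.-integrable setT (fun x => (x ^+ n)%:E).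
Proof.
apply/(integrable_density (P := mu) (Z := id) (Z' := id) (Y := normal_pdf 0 sd) _ _ _ _ _
  (g := fun x => x ^+ n)) => //.
- exact: measurable_normal_pdf.
- by move=> w; exact: normal_pdf_ge0.
Qed.

Let half_normal_momentE n : half_normal_moment n = peak * \int[mu]_x (x ^+ n * gauss_fun x).
Proof.
rewrite -(RintegralZl _ measurableT (integrable_pow_gauss R n)) /half_normal_moment.
rewrite -(Rintegral_density (P := mu) (Q := nu) (Z := id) (Z' := id) (Y := normal_pdf 0 sd) _ _ _ _ _
  (g := fun x => x ^+ n)) //.
- by apply: eq_Rintegral => x _; rewrite pdfE mulrCA.
- exact: measurable_normal_pdf.
- by move=> w; exact: normal_pdf_ge0.
- exact: integrable_half_normal.
Qed.

Lemma half_normal_moment1 : half_normal_moment 1 = 0.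
Proof. by rewrite half_normal_momentE gauss_integral1 mulr0. Qed.

Lemma half_normal_momentSS n :
  half_normal_moment n.+2 = n.+1%:R / 2 * half_normal_moment n.
Proof. by rewrite !half_normal_momentE gauss_integralSS mulrCA. Qed.

End NormalMoments.

(** * The real coordinates of a complex Gaussian family *)

Section GaussianFamily.
Context {d : measure_display} {T : measurableType d} {R : realType}.
Variable P : probability T R.
Variables (I : finType) (g : I -> T -> R[i]).
Hypothesis gG : forall i, std_complex_gaussian P (g i).
Hypothesis gI : independent_family P g.
Notation sd := (Num.sqrt 2^-1 : R).
Notation nu := (normal_prob 0 sd).

(** The real and imaginary parts together are independent variables of the same
    law, which lets integration by parts treat one real variable at a time. *)
Definition real_coord (v : I * bool) (w : T) : R :=
  if v.2 then complex.Im (g v.1 w) else complex.Re (g v.1 w).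

Lemma measurable_real_coord v : measurable_fun setT (real_coord v).
Proof.
have [mg _] := gG v.1.
have -> : real_coord v = (if v.2 then snd else fst) \o (coords \o g v.1).
  by apply/funext => w; rewrite /real_coord /=; case: v.2.
by apply: measurableT_comp => //; case: v.2.
Qed.

Lemma real_coord_law v A : measurable A -> P (real_coord v @^-1` A) = nu A.
Proof.
move=> mA; have [_ law] := gG v.1.
have nuT : nu setT = 1%E by exact: probability_setT.
have -> : real_coord v @^-1` A =
   (coords \o g v.1) @^-1` (if v.2 then setT `*` A else A `*` setT).
  apply/seteqP; split=> w; rewrite /real_coord /=; case: v.2 => /=; tauto.
rewrite law; last by case: v.2; exact: measurableX.
by case: v.2; rewrite product_measure1E //= nuT ?mul1e ?mule1.
Qed.

(** Distinct entries are independent by hypothesis; the two parts of one entry are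
    independent because its law is a product measure. *)
Lemma real_coord_independent (A : I * bool -> set R) : (forall v, measurable (A v)) ->
  P (\bigcap_v (real_coord v @^-1` A v)) = (\prod_v P (real_coord v @^-1` A v))%E.
Proof.
move=> mA; pose C i := A (i, false) `*` A (i, true).
have mC i : measurable (C i) by exact: measurableX.
have -> : \bigcap_v (real_coord v @^-1` A v) = \bigcap_(i in [set` [set: I]%SET]) ((coords \o g i) @^-1` C i).
  apply/seteqP; split=> w H.
    by move=> i _; split; [exact: (H (i, false))|exact: (H (i, true))].
  by move=> [i []] _; have [] := H i (finset.in_setT i).
rewrite gI //.
transitivity (\prod_i P ((coords \o g i) @^-1` C i))%E.
  by apply: eq_bigl => i; rewrite finset.in_setT.
transitivity (\prod_i \prod_b P (real_coord (i, b) @^-1` A (i, b)))%E.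
  apply: eq_bigr => i _; rewrite big_bool /= !real_coord_law // muleC.
  have [_ ->] := gG i; last exact: mC.
  by rewrite product_measure1E //; exact: mA.
by rewrite pair_big /=; apply: eq_bigr => -[i b] _.
Qed.

Definition real_monomial (n : I * bool -> nat) (w : T) : R := \prod_v real_coord v w ^+ n v.

Let pow_transfer v k :
  P.-integrable setT (fun w => (real_coord v w ^+ k)%:E) /\
  \int[P]_w real_coord v w ^+ k = half_normal_moment R k.
Proof.
have mx := measurable_real_coord v.
have dens A : measurable A -> (\int[P]_w (\1_A (real_coord v w) * 1)%:E = nu (id @^-1` A))%E.
  move=> mA; under eq_integral do rewrite mulr1.
  have -> : (fun w => (\1_A (real_coord v w))%:E) = (fun w => (\1_(real_coord v @^-1` A) w)%:E :> \bar R) by [].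
  rewrite integral_indic ?setIT //; first by apply: etrans (real_coord_law v mA) _.
  by rewrite -[X in measurable X]setTI; exact: mx.
have mp : measurable_fun setT ((fun x => x ^+ k) : R -> R) by exact: measurable_funX.
have m1 : measurable_fun setT ((fun=> 1) : T -> R) by exact: measurable_cst.
have p0 : forall w : T, 0 <= (fun=> 1 : R) w by [].
have mid : measurable_fun setT (id : R -> R) by exact: measurable_id.
have ih := integrable_half_normal R k.
split.
  have := (integrable_density (Q := nu) mx m1 mid p0 dens mp).2 ih.
  by apply: eq_integrable => // w _; rewrite mulr1.
rewrite /half_normal_moment -(Rintegral_density (Q := nu) mx m1 mid p0 dens mp ih).
by apply: eq_Rintegral => w _; rewrite mulr1.
Qed.

Lemma integrable_real_monomial n : P.-integrable setT (fun w => (real_monomial n w)%:E).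
Proof.
apply: (independent_prod_integrable measurable_real_coord real_coord_independent
  (f := fun v x => x ^+ n v)) => v; first exact: measurable_funX.
exact: (pow_transfer v (n v)).1.
Qed.

Lemma Rintegral_real_monomial n :
  \int[P]_w real_monomial n w = \prod_v half_normal_moment R (n v).
Proof.
rewrite (independent_prod measurable_real_coord real_coord_independent
  (f := fun v x => x ^+ n v)).
- by apply: eq_bigr => v _; exact: (pow_transfer v (n v)).2.
- by move=> v; exact: measurable_funX.
- by move=> v; exact: (pow_transfer v (n v)).1.
Qed.

(** For a monomial F this is E[x_s F] = 1/2 E[dF / dx_s]; by independence it is the
    recurrence of the moments of x_s. *)
Lemma real_monomial_ibp n s :
  \int[P]_w real_monomial (fun v => n v + (v == s))%N w =
  (n s)%:R / 2 * \int[P]_w real_monomial (fun v => n v - (v == s))%N w.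
Proof.
rewrite !Rintegral_real_monomial (bigD1 s) //= [in RHS](bigD1 s) //= eqxx mulrA.
congr (_ * _); last first.
  by apply: eq_bigr => v /negbTE ->; rewrite addn0 subn0.
case: (n s) => [|[|k]].
- by rewrite !mul0r half_normal_moment1.
- by rewrite half_normal_momentSS.
- by rewrite addn1 half_normal_momentSS subn1.
Qed.

End GaussianFamily.

(** * Complex expectation *)

Section ComplexExpectation.
Context {d : measure_display} {T : measurableType d} {R : realType}.
Variable P : probability T R.
Local Notation EC := (cexpectation P).
Implicit Types X Y : T -> R[i].

Definition cintegrable X :=
  P.-integrable setT (fun w => (complex.Re (X w))%:E) /\
  P.-integrable setT (fun w => (complex.Im (X w))%:E).

Lemma cexpectationE X :
  EC X = Complex (\int[P]_w complex.Re (X w)) (\int[P]_w complex.Im (X w)).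
Proof. by rewrite /cexpectation unlock. Qed.

Lemma cintegrableD X Y :
  cintegrable X -> cintegrable Y -> cintegrable (fun w => X w + Y w).
Proof.
move=> [X1 X2] [Y1 Y2]; split.
  have := integrableD measurableT X1 Y1; apply: eq_integrable => // w _.
  by case: (X w) => a b; case: (Y w).
have := integrableD measurableT X2 Y2; apply: eq_integrable => // w _.
by case: (X w) => a b; case: (Y w).
Qed.

Lemma cexpectationD X Y : cintegrable X -> cintegrable Y ->
  EC (fun w => X w + Y w) = EC X + EC Y.
Proof.
move=> [X1 X2] [Y1 Y2]; rewrite !cexpectationE.
transitivity (Complex (\int[P]_w (complex.Re (X w) + complex.Re (Y w)))
                      (\int[P]_w (complex.Im (X w) + complex.Im (Y w)))).
  by congr Complex; apply: eq_Rintegral => w _; case: (X w) => a b; case: (Y w).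
by rewrite (RintegralD measurableT X1 Y1) (RintegralD measurableT X2 Y2).
Qed.

Let integrable_lin a b (f h : T -> R) : P.-integrable setT (EFin \o f) ->
  P.-integrable setT (EFin \o h) -> P.-integrable setT (fun w => (a * f w + b * h w)%:E).
Proof.
move=> intf inth.
have := integrableD measurableT (integrableZl measurableT a intf) (integrableZl measurableT b inth).
by apply: eq_integrable => // w _; rewrite EFinD !EFinM.
Qed.

Let Rintegral_lin a b (f h : T -> R) : P.-integrable setT (EFin \o f) ->
  P.-integrable setT (EFin \o h) ->
  \int[P]_w (a * f w + b * h w) = a * \int[P]_w f w + b * \int[P]_w h w.
Proof.
move=> intf inth; rewrite RintegralD //.
- by rewrite !RintegralZl.
- by have := integrableZl measurableT a intf; apply: eq_integrable => // w _; rewrite EFinM.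
- by have := integrableZl measurableT b inth; apply: eq_integrable => // w _; rewrite EFinM.
Qed.

Lemma cintegrableZ a X : cintegrable X -> cintegrable (fun w => a * X w).
Proof.
case: a => a b [X1 X2]; split.
  have := integrable_lin a (- b) X1 X2; apply: eq_integrable => // w _ /=.
  by case: (X w) => x y /=; rewrite mulNr.
have := integrable_lin b a X1 X2; apply: eq_integrable => // w _ /=.
by case: (X w) => x y /=; rewrite addrC.
Qed.

Lemma cexpectationZ a X : cintegrable X -> EC (fun w => a * X w) = a * EC X.
Proof.
case: a => a b [X1 X2]; rewrite !cexpectationE.
transitivity (Complex (\int[P]_w (a * complex.Re (X w) + (- b) * complex.Im (X w)))
                      (\int[P]_w (b * complex.Re (X w) + a * complex.Im (X w)))).
  congr Complex; apply: eq_Rintegral => w _; case: (X w) => x y /=; first by rewrite mulNr.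
  by rewrite addrC.
rewrite (Rintegral_lin _ _ X1 X2) (Rintegral_lin _ _ X1 X2) mulNr.
by congr Complex; rewrite addrC.
Qed.

Lemma cintegrable0 : cintegrable (fun=> 0).
Proof. by split; exact: integrable0. Qed.

Lemma cexpectation0 : EC (fun=> 0) = 0.
Proof. by rewrite cexpectationE /= !Rintegral_cst //= !mul0r. Qed.

Lemma cintegrable_sum (J : Type) (s : seq J) (A : pred J) (X : J -> T -> R[i]) :
  (forall j, A j -> cintegrable (X j)) -> cintegrable (fun w => \sum_(j <- s | A j) X j w).
Proof.
move=> cX; elim: s => [|j s IH].
  by under eq_fun do rewrite big_nil; exact: cintegrable0.
under eq_fun do rewrite big_cons.
by case: (boolP (A j)) => // Aj; apply: cintegrableD => //; exact: cX.
Qed.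

Lemma cexpectation_sum (J : Type) (s : seq J) (A : pred J) (X : J -> T -> R[i]) :
  (forall j, A j -> cintegrable (X j)) ->
  EC (fun w => \sum_(j <- s | A j) X j w) = \sum_(j <- s | A j) EC (X j).
Proof.
move=> cX; elim: s => [|j s IH].
  by under eq_fun do rewrite big_nil; rewrite big_nil cexpectation0.
under eq_fun do rewrite big_cons; rewrite big_cons.
case: (boolP (A j)) => // Aj; rewrite cexpectationD ?IH //; first exact: cX.
exact: cintegrable_sum.
Qed.

Lemma cintegrable_real (f : T -> R) : P.-integrable setT (EFin \o f) ->
  cintegrable (fun w => (f w)%:C%C).
Proof. by move=> intf; split=> //=; exact: integrable0. Qed.

Lemma cexpectation_real (f : T -> R) : EC (fun w => (f w)%:C%C) = (\int[P]_w f w)%:C%C.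
Proof. by rewrite cexpectationE /= Rintegral_cst //= mul0r. Qed.

End ComplexExpectation.

(** * Gaussian integration by parts *)

Section Wick.
Context {d : measure_display} {T : measurableType d} {R : realType}.
Variable P : probability T R.
Variables (I : finType) (g : I -> T -> R[i]).
Hypothesis gG : forall i, std_complex_gaussian P (g i).
Hypothesis gI : independent_family P g.
Local Notation EC := (cexpectation P).
Local Notation V := (I * bool)%type.
Local Notation X := (real_coord g).

Section LinearForms.
Variables (J : finType) (cf : J -> V -> R[i]).

Definition linear_form (j : J) (w : T) : R[i] := \sum_v cf j v * (X v w)%:C%C.

(** A monomial times linear forms: this class contains the products to be
    integrated and is stable under expanding a form into coordinates, so that
    integration by parts can be proved by induction on the number of forms. *)
Definition mixed_monomial (n : V -> nat) (S : {set J}) (w : T) : R[i] :=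
  (real_monomial g n w)%:C%C * \prod_(j in S) linear_form j w.

Let raise n v : V -> nat := fun u => (n u + (u == v))%N.
Let lower n v : V -> nat := fun u => (n u - (u == v))%N.

Let mixed_monomialD1 n (S : {set J}) j w : j \in S ->
  mixed_monomial n S w = \sum_v cf j v * mixed_monomial (raise n v) (S :\ j)%SET w.
Proof.
move=> jS; rewrite /mixed_monomial (big_setD1 j) //= {1}/linear_form mulrCA mulr_suml.
apply: eq_bigr => v _; rewrite -!mulrA; congr (_ * _); rewrite !mulrA; congr (_ * _).
rewrite -rmorphM; congr (_%:C%C); rewrite /real_monomial.
rewrite (bigD1 v) //= [in RHS](bigD1 v) //= /raise eqxx addn1 exprS -mulrA; congr (_ * (_ * _)).
by apply: eq_bigr => u /negbTE ->; rewrite addn0.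
Qed.

Lemma cintegrable_mixed n S : cintegrable P (mixed_monomial n S).
Proof.
have [k Sk] := ubnP #|S|; elim: k => // k IH in n S Sk *.
have [->|[j jS]] := set_0Vmem S.
  rewrite (_ : mixed_monomial n _ = fun w => (real_monomial g n w)%:C%C).
    by apply: cintegrable_real; exact: integrable_real_monomial.
  by apply/funext => w; rewrite /mixed_monomial big_set0 mulr1.
rewrite (_ : mixed_monomial n S = fun w => \sum_v cf j v * mixed_monomial (raise n v) (S :\ j)%SET w).
  apply: cintegrable_sum => v _; apply: cintegrableZ; apply: IH.
  by move: Sk; rewrite (cardsD1 j) jS.
by apply/funext => w; exact: mixed_monomialD1.
Qed.

Let EC_mixedD1 n (S : {set J}) j : j \in S ->
  EC (mixed_monomial n S) = \sum_v cf j v * EC (mixed_monomial (raise n v) (S :\ j)%SET).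
Proof.
move=> jS.
rewrite (_ : mixed_monomial n S = fun w => \sum_v cf j v * mixed_monomial (raise n v) (S :\ j)%SET w).
  rewrite cexpectation_sum => [|v _]; last by apply: cintegrableZ; exact: cintegrable_mixed.
  by apply: eq_bigr => v _; rewrite cexpectationZ //; exact: cintegrable_mixed.
by apply/funext => w; exact: mixed_monomialD1.
Qed.

(** This is E[x_s F] = 1/2 E[dF / dx_s], where 1/2 is the variance of a
    coordinate: the first term differentiates the monomial and the sum
    differentiates the linear forms. *)
Lemma gaussian_ibp n s S :
  EC (mixed_monomial (raise n s) S) =
  2^-1 * ((n s)%:R * EC (mixed_monomial (lower n s) S) +
          \sum_(j in S) cf j s * EC (mixed_monomial n (S :\ j)%SET)).
Proof.
have [k Sk] := ubnP #|S|; elim: k => // k IH in n S Sk *.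
have [->|[j jS]] := set_0Vmem S.
  have E0 m : EC (mixed_monomial m finset.set0) = (\int[P]_w real_monomial g m w)%:C%C.
    rewrite -cexpectation_real; congr cexpectation; apply/funext => w.
    by rewrite /mixed_monomial big_set0 mulr1.
  rewrite big_set0 addr0 !E0 (real_monomial_ibp gG gI) rmorphM /= mulrA; congr (_ * _).
  by rewrite mulrC rmorphM fmorphV !rmorph_nat.
have cj : (#|(S :\ j)%SET| < k)%N by move: Sk; rewrite (cardsD1 j S) jS.
rewrite (EC_mixedD1 _ jS) (EC_mixedD1 (lower n s) jS).
have bb v : raise (raise n s) v = raise (raise n v) s.
  by apply/funext => u; rewrite /raise addnAC.
under eq_bigr => v _ do rewrite bb (IH _ _ cj) mulrCA.
rewrite -mulr_sumr; congr (_ * _).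
under eq_bigr => v _ do rewrite mulrDr.
rewrite big_split /= [X in _ = _ + X](bigD1 j) //= addrA; congr (_ + _).
  transitivity (\sum_v ((v == s)%:R * (cf j v * EC (mixed_monomial n (S :\ j)%SET))
     + (n s)%:R * (cf j v * EC (mixed_monomial (raise (lower n s) v) (S :\ j)%SET)))).
    apply: eq_bigr => v _; rewrite /raise [s == v]eq_sym natrD mulrDl mulrDr addrC; congr (_ + _).
      have [->|_] := eqVneq v s; last by rewrite !mul0r mulr0.
      rewrite !mul1r; congr (_ * EC (mixed_monomial _ _)); apply/funext => u.
      by rewrite /lower addnK.
    rewrite mulrCA; case: (posnP (n s)) => [->|ns]; first by rewrite !mul0r.
    congr (_ * (_ * EC (mixed_monomial _ _))); apply/funext => u; rewrite /lower.
    by have [->|] := eqVneq u s; lia.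
  rewrite big_split /= addrC mulr_sumr; congr (_ + _).
  rewrite (bigD1 s) //= eqxx mul1r big1 ?addr0 // => v /negbTE ->; by rewrite mul0r.
under eq_bigr => v _ do rewrite mulr_sumr.
rewrite exchange_big /=.
transitivity (\sum_(i in (S :\ j)%SET) cf i s * EC (mixed_monomial n (S :\ i)%SET)).
  apply: eq_bigr => i; rewrite finset.in_setD1 => /andP[ij iS].
  rewrite (@EC_mixedD1 _ (S :\ i)%SET j); last by rewrite finset.in_setD1 eq_sym ij.
  rewrite mulr_sumr; apply: eq_bigr => v _; rewrite mulrCA; congr (_ * (_ * EC (mixed_monomial _ _))).
  by apply/setP => u; rewrite !finset.in_setD1; case: (u == i); case: (u == j).
by apply: eq_bigl => i; rewrite finset.in_setD1 andbC.
Qed.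

(** Integration by parts pairs the first form with each of the others, the weight
    being the covariance 1/2 sum_v c0 v * cf j v. *)
Lemma wick_recursion (S : {set J}) (c0 : V -> R[i]) :
  EC (fun w => (\sum_v c0 v * (X v w)%:C%C) * \prod_(j in S) linear_form j w) =
  \sum_(j in S) (2^-1 * \sum_v c0 v * cf j v) *
    EC (fun w => \prod_(i in (S :\ j)%SET) linear_form i w).
Proof.
have E0 (S' : {set J}) : (fun w => \prod_(i in S') linear_form i w) = mixed_monomial (fun=> 0%N) S'.
  apply/funext => w; rewrite /mixed_monomial (_ : real_monomial g _ w = 1) ?mul1r //.
  by apply: big1 => v _; rewrite expr0.
have E1 : (fun w => (\sum_v c0 v * (X v w)%:C%C) * \prod_(j in S) linear_form j w) =
    (fun w => \sum_v c0 v * mixed_monomial (raise (fun=> 0%N) v) S w).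
  apply/funext => w; rewrite mulr_suml; apply: eq_bigr => v _.
  rewrite -mulrA; congr (_ * (_%:C%C * _)).
  rewrite /real_monomial (bigD1 v) //= /raise eqxx expr1 big1 ?mulr1 // => u /negbTE ->.
  by rewrite expr0.
rewrite E1 cexpectation_sum => [|v _]; last by apply: cintegrableZ; exact: cintegrable_mixed.
under eq_bigr => v _.
  rewrite cexpectationZ; last exact: cintegrable_mixed.
  rewrite gaussian_ibp mul0r add0r mulrCA mulr_sumr.
  over.
rewrite -mulr_sumr exchange_big /= mulr_sumr; apply: eq_bigr => j _.
rewrite -E0 -mulrA mulr_suml; congr (_ * _); apply: eq_bigr => v _.
by rewrite mulrA.
Qed.

End LinearForms.
End Wick.

(** * The Wick formula for complex Gaussian variables *)

Section ComplexWick.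
Context {d : measure_display} {T : measurableType d} {R : realType}.
Variable P : probability T R.
Variables (I : finType) (g : I -> T -> R[i]).
Hypothesis gG : forall i, std_complex_gaussian P (g i).
Hypothesis gI : independent_family P g.
Local Notation EC := (cexpectation P).
Variable K : finType.
Implicit Types (f h : K -> I) (A B S : {set K}).

Section Pairing.
Variables (f h : K -> I).

(** Both a variable Re + 'i Im and a conjugate Re - 'i Im are linear forms in the
    real coordinates, so that wick_recursion applies to products of both kinds. *)
Definition slot_coef (j : K + K) (v : I * bool) : R[i] :=
  match j with
  | inl i => (v.1 == f i)%:R * (if v.2 then 'i%C else 1)
  | inr i => (v.1 == h i)%:R * (if v.2 then - 'i%C else 1)
  end.

Let slots A B : {set K + K} :=
  [set j | match j with inl i => i \in A | inr i => i \in B end]%SET.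

Let sum_coords (F : I * bool -> R[i]) (i0 : I) (a b : R[i]) :
  (forall i, F (i, false) = (i == i0)%:R * a) -> (forall i, F (i, true) = (i == i0)%:R * b) ->
  \sum_v F v = a + b.
Proof.
move=> F1 F2; transitivity (\sum_i \sum_c F (i, c)).
  by rewrite pair_big /=; apply: eq_bigr => -[].
rewrite (bigD1 i0) //= big_bool /= F1 F2 eqxx !mul1r addrC [X in _ + X]addrC.
by rewrite big1 ?add0r // => i /negbTE ni; rewrite big_bool /= F1 F2 ni !mul0r addr0.
Qed.

Let linear_form_inl i w : linear_form g slot_coef (inl i) w = g (f i) w.
Proof.
rewrite /linear_form (@sum_coords _ (f i) (complex.Re (g (f i) w))%:C%C ('i%C * (complex.Im (g (f i) w))%:C%C)).
- by rewrite -complexE.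
- by move=> j; rewrite /= /real_coord /= mulr1; case: eqP => [->|] //; rewrite !mul0r.
- by move=> j; rewrite /= /real_coord /= -mulrA; case: eqP => [->|] //; rewrite !mul0r.
Qed.

Let linear_form_inr i w : linear_form g slot_coef (inr i) w = ((g (h i) w)^*)%C.
Proof.
rewrite /linear_form (@sum_coords _ (h i) (complex.Re (g (h i) w))%:C%C (- 'i%C * (complex.Im (g (h i) w))%:C%C)).
- by case: (g (h i) w) => a b; simpc.
- by move=> j; rewrite /= /real_coord /= mulr1; case: eqP => [->|] //; rewrite !mul0r.
- by move=> j; rewrite /= /real_coord /= -mulrA; case: eqP => [->|] //; rewrite !mul0r.
Qed.

Definition slot_product A B w : R[i] :=
  (\prod_(i in A) g (f i) w) * \prod_(i in B) ((g (h i) w)^*)%C.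

Let slot_productE A B w : slot_product A B w = \prod_(j in slots A B) linear_form g slot_coef j w.
Proof.
rewrite big_sumType /=; congr (_ * _); apply: eq_big => [i|i _]; rewrite ?inE //.
Qed.

Lemma cintegrable_slot_product A B : cintegrable P (slot_product A B).
Proof.
have -> : slot_product A B = mixed_monomial g slot_coef (fun=> 0%N) (slots A B).
  apply/funext => w; rewrite /mixed_monomial (_ : real_monomial g _ w = 1) ?mul1r ?slot_productE //.
  by apply: big1 => v _; rewrite expr0.
exact: cintegrable_mixed.
Qed.

Let ii : 'i%C * 'i%C = -1 :> R[i].
Proof. by rewrite -expr2 sqr_i. Qed.

(** Two variables that are not conjugated are never paired: their covariance is
    (1 + 'i^2) / 2 = 0 when they are equal, and otherwise they are independent. A
    variable and its own conjugate have covariance (1 - 'i^2) / 2 = 1. *)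
Lemma slot_product_recursion A B i0 : i0 \in A ->
  EC (slot_product A B) =
  \sum_(i in B) (f i0 == h i)%:R * EC (slot_product (A :\ i0)%SET (B :\ i)%SET).
Proof.
move=> iA.
have -> : slot_product A B = (fun w => (\sum_v slot_coef (inl i0) v * (real_coord g v w)%:C%C) *
    \prod_(j in slots (A :\ i0)%SET B) linear_form g slot_coef j w).
  apply/funext => w; rewrite -slot_productE -/(linear_form g slot_coef (inl i0) w) linear_form_inl.
  by rewrite /slot_product (big_setD1 i0) //= mulrA.
rewrite (wick_recursion gG gI) big_sumType /= big1 ?add0r; last first.
  move=> i _; rewrite (@sum_coords _ (f i0) (f i0 == f i)%:R (- (f i0 == f i)%:R)) ?subrr ?mulr0 ?mul0r //.
  - by move=> j; rewrite /= !mulr1; case: eqP => [->|] //; rewrite !mul0r.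
  - move=> j; rewrite /=; case: eqP => [->|]; last by rewrite !mul0r.
    by rewrite !mul1r mulrCA ii mulrN1.
apply: eq_big => [i|i]; rewrite inE // => iB.
rewrite (@sum_coords _ (f i0) (f i0 == h i)%:R (f i0 == h i)%:R).
- congr (_ * EC _); first by rewrite -mulr2n -[X in _ * X]mulr_natl mulKf ?pnatr_eq0.
  apply/funext => w; rewrite slot_productE; apply: eq_bigl => -[j|j]; rewrite !inE //=.
- by move=> j; rewrite /= !mulr1; case: eqP => [->|] //; rewrite !mul0r.
- move=> j; rewrite /=; case: eqP => [->|]; last by rewrite !mul0r.
  by rewrite !mul1r mulrCA mulrN ii opprK mulr1.
Qed.
End Pairing.

Lemma perm_on_fixed S (s : {perm K}) i : perm_on (S :\ i)%SET s = perm_on S s && (s i == i).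
Proof.
apply/fintype.subsetP/andP => [H|[/fintype.subsetP H /eqP si] j sj].
  split; first by apply/fintype.subsetP => j /H; rewrite finset.in_setD1 => /andP[].
  by apply: contraT => si; have := H i si; rewrite finset.in_setD1 eqxx.
by rewrite finset.in_setD1 H // andbT; apply: contraNneq sj => ->; rewrite /= si.
Qed.

(** By slot_product_recursion, the entry i0 is matched with some conjugate i1.
    Composing with the transposition of i0 and i1 turns the permutations with
    s i0 = i1 into those that fix i0, which are the permutations of the remaining
    slots. *)
Theorem wick S f h :
  EC (fun w => \prod_(i in S) (g (f i) w * ((g (h i) w)^*)%C)) =
  \sum_(s : {perm K} | perm_on S s) \prod_(i in S) (f i == h (s i))%:R.
Proof.
have prodE f' h' S' : (fun w => \prod_(i in S') (g (f' i) w * ((g (h' i) w)^*)%C)) = slot_product f' h' S' S'.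
  by apply/funext => w; rewrite /slot_product big_split.
have [k Sk] := ubnP #|S|; elim: k => // k IH in S f h Sk *.
have [S0|[i0 i0S]] := set_0Vmem S.
  rewrite S0 (big_pred1 (1%g : {perm K})).
    rewrite big_set0 (_ : (fun w => _) = (fun=> 1%:C%C)); last first.
      by apply/funext => w; rewrite big_set0.
    by rewrite cexpectation_real Rintegral_probability1.
  move=> s; apply/idP/eqP => [H|->]; last exact: perm_on1.
  by apply/permP => i; rewrite perm1 (out_perm H) // inE.
rewrite prodE (slot_product_recursion _ _ _ i0S).
have ck : (#|(S :\ i0)%SET| < k)%N by move: Sk; rewrite (cardsD1 i0 S) i0S.
rewrite (partition_big (fun s : {perm K} => s i0) (mem S)) /=; last first.
  by move=> s sS; rewrite (perm_closed _ sS).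
apply: eq_bigr => i1 i1S.
have tS : perm_on S (tperm i0 i1).
  apply/fintype.subsetP => j; rewrite /= => jt.
  have [->//|n0] := eqVneq j i0; have [->//|n1] := eqVneq j i1.
  by rewrite inE tpermD ?eqxx // eq_sym in jt.
rewrite (reindex_inj (mulIg (tperm i0 i1))) /=.
have -> : slot_product f h (S :\ i0)%SET (S :\ i1)%SET =
    slot_product f (h \o tperm i0 i1) (S :\ i0)%SET (S :\ i0)%SET.
  apply/funext => w; rewrite /slot_product; congr (_ * _).
  rewrite (reindex_inj (h := tperm i0 i1)) /=; last exact: perm_inj.
  apply: eq_bigl => i; rewrite !finset.in_setD1 (perm_closed _ tS); congr (_ && _).
  by rewrite -{2}(tpermL i0 i1) (inj_eq perm_inj).
rewrite -prodE IH // mulr_sumr; apply: eq_big => [s|s sP].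
  have -> : ((s * tperm i0 i1)%g i0 == i1) = (s i0 == i0).
    by rewrite permM -[X in _ == X](tpermL i0 i1) (inj_eq perm_inj).
  rewrite perm_on_fixed; congr (_ && _).
  apply/idP/idP => H; first exact: perm_onM.
  by rewrite -[s]mulg1 -(tperm2 i0 i1) mulgA perm_onM.
rewrite perm_on_fixed in sP; have /andP[_ /eqP si0] := sP.
rewrite [RHS](big_setD1 i0) //= permM si0 tpermL; congr (_ * _).
by apply: eq_bigr => i _; rewrite permM.
Qed.

Lemma cintegrable_wick S f h : cintegrable P (fun w => \prod_(i in S) (g (f i) w * ((g (h i) w)^*)%C)).
Proof.
have -> : (fun w => \prod_(i in S) (g (f i) w * ((g (h i) w)^*)%C)) = slot_product f h S S.
  by apply/funext => w; rewrite /slot_product big_split.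
exact: cintegrable_slot_product.
Qed.

Let centered_expand (t : R[i]) f h w :
  \prod_i (g (f i) w * ((g (h i) w)^*)%C - t * (f i == h i)%:R) =
  \sum_(S : {set K}) (\prod_(i | i \notin S) (- t * (f i == h i)%:R)) *
    \prod_(i in S) (g (f i) w * ((g (h i) w)^*)%C).
Proof.
rewrite bigA_distr; apply: eq_bigr => S _.
rewrite (bigID (mem S)) /= mulrC; congr (_ * _); apply: eq_bigr => i.
  by move=> /negbTE ->; rewrite mulNr.
by move=> ->.
Qed.

Lemma cintegrable_centered (t : R[i]) f h :
  cintegrable P (fun w => \prod_i (g (f i) w * ((g (h i) w)^*)%C - t * (f i == h i)%:R)).
Proof.
under eq_fun do rewrite centered_expand.
by apply: cintegrable_sum => S _; apply: cintegrableZ; exact: cintegrable_wick.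
Qed.

(** In the expansion, S is the set of the slots where the product is kept; the
    other slots contribute - t times the diagonal indicator.  A permutation s occurs
    for all S that contain its support, so each fixed point of s gets the factor
    1 - t. *)
Theorem centered_wick (t : R[i]) f h :
  EC (fun w => \prod_i (g (f i) w * ((g (h i) w)^*)%C - t * (f i == h i)%:R)) =
  \sum_(s : {perm K}) (\prod_i (if s i == i then 1 - t else 1)) * \prod_i (f i == h (s i))%:R.
Proof.
under eq_fun do rewrite centered_expand.
rewrite cexpectation_sum; last by move=> S _; apply: cintegrableZ; exact: cintegrable_wick.
under eq_bigr => S _.
  rewrite cexpectationZ; last exact: cintegrable_wick.
  rewrite wick mulr_sumr big_mkcond /=.
  over.
rewrite exchange_big /=; apply: eq_bigr => s _.
have -> : \prod_i (if s i == i then 1 - t else 1) = \prod_i (1 + (if s i == i then - t else 0)).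
  by apply: eq_bigr => i _; case: eqP => // _; rewrite addr0.
rewrite bigA_distr mulr_suml; apply: eq_bigr => S _.
have [sS|sS] := boolP (perm_on S s).
  have -> : \prod_i (if i \in S then 1 else if s i == i then - t else 0) = \prod_(i | i \notin S) - t.
    rewrite [LHS](bigID (mem S)) /= [X in X * _]big1 ?mul1r; last by move=> i ->.
    by apply: eq_bigr => i iS; rewrite (negbTE iS) (out_perm sS iS) eqxx.
  rewrite [X in _ = _ * X](bigID (mem S)) /= mulrCA mulrC; congr (_ * _).
  rewrite -big_split; apply: eq_bigr => i iS /=.
  by rewrite (out_perm sS iS).
have [i /andP[si iS]] : exists i, (s i != i) && (i \notin S).
  apply/existsP; apply: contraR sS => /existsPn H; apply/fintype.subsetP => i si.
  by have := H i; rewrite inE in si; rewrite si /= negbK.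
by rewrite [X in X * _](bigD1 i) //= (negbTE iS) (negbTE si) !mul0r.
Qed.

End ComplexWick.

(** * Traces of powers as sums over closed walks *)

Section TracePower.
Variables (K : comNzRingType) (D : nat) (M : 'M[K]_D).

(** The last step of a path reads the sequence beyond its end, where nth returns
    its default value, the endpoint y. *)
Lemma mxpow_paths k (x y : 'I_D) : (M ^+ k.+1) x y =
  \sum_(t : k.-tuple 'I_D) \prod_(i < k.+1) M (nth y (x :: t) i) (nth y (x :: t) i.+1).
Proof.
elim: k x => [|k IH] x.
  rewrite expr1 (big_pred1 [tuple]) => [|t]; last by apply/esym/eqP; exact: tuple0.
  by rewrite big_ord1.
rewrite exprS mxE.
under eq_bigr => z _ do rewrite IH mulr_sumr.
rewrite pair_big /=.
rewrite [RHS](reindex (fun zt : 'I_D * k.-tuple 'I_D => cons_tuple zt.1 zt.2)) /=.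
  by apply: eq_bigr => -[z t] _; rewrite [RHS]big_ord_recl.
exists (fun t : k.+1.-tuple 'I_D => (thead t, behead_tuple t)) => [[z t] _|t _] /=.
  by rewrite theadE; congr pair; apply: val_inj.
by apply: val_inj; rewrite /= [in RHS](tuple_eta t).
Qed.

Lemma mxtrace_pow k : \tr (M ^+ k.+1) =
  \sum_(a : {ffun 'I_k.+1 -> 'I_D}) \prod_(i < k.+1) M (a i) (a (ordS i)).
Proof.
rewrite /mxtrace; under eq_bigr => x _ do rewrite mxpow_paths.
rewrite pair_big /=.
rewrite [RHS](reindex (fun xt : 'I_D * k.-tuple 'I_D => [ffun i => tnth (cons_tuple xt.1 xt.2) i])) /=.
  apply: eq_bigr => -[x t] _; apply: eq_bigr => i _; rewrite !ffunE !(tnth_nth x) /=.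
  have [ik|ik] := ltnP i k; first by rewrite modn_small.
  have -> : i = k :> nat by have := ltn_ord i; lia.
  by rewrite modnn /= [nth x t k]nth_default ?size_tuple.
exists (fun a : {ffun 'I_k.+1 -> 'I_D} => (a ord0, [tuple a (lift ord0 i) | i < k])) => [[x t] _|a _] /=.
  congr pair; first by rewrite ffunE tnth0.
  by apply: eq_from_tnth => i; rewrite tnth_mktuple ffunE tnthS.
apply/ffunP => i; rewrite ffunE; case: (unliftP ord0 i) => [j|] ->; first by rewrite tnthS tnth_mktuple.
by rewrite tnth0.
Qed.
End TracePower.

(** * Counting row indices *)

Section IndexCount.
Variables (n : nat) (d : 'I_n -> nat) (L : nat).
Implicit Types (s : 'S_L.+1) (x : {ffun 'I_L.+1 -> {ffun 'I_n -> bool}}).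

Let coordinates (a : {ffun 'I_L.+1 -> 'I_(tdim d)}) :
  {dffun forall j : 'I_n, {ffun 'I_L.+1 -> 'I_(d j)}} :=
  [ffun j => [ffun i => midx_of (a i) j]].

Let coordinates_bij : bijective coordinates.
Proof.
exists (fun b : {dffun forall j : 'I_n, {ffun 'I_L.+1 -> 'I_(d j)}} =>
  [ffun i => of_midx [ffun j => b j i]]) => [a|b].
  apply/ffunP => i; rewrite ffunE -[RHS]midx_ofK; congr of_midx.
  by apply/ffunP => j; rewrite !ffunE.
apply/ffunP => j; apply/ffunP => i; rewrite !ffunE of_midxK ffunE //.
Qed.

Lemma midx_mixE y (a b : 'I_(tdim d)) j :
  midx_of (midx_mix y a b) j = if y j then midx_of b j else midx_of a j.
Proof. by rewrite of_midxK ffunE. Qed.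

Lemma midx_mix_eq y (a b : 'I_(tdim d)) : (midx_mix y a b == midx_mix y b a) = (a == b).
Proof.
apply/eqP/eqP => [/(congr1 (@midx_of n d))/ffunP E|->] //.
rewrite -[a]midx_ofK -[b]midx_ofK; congr of_midx; apply/ffunP => j.
by have := E j; rewrite !midx_mixE; case: (y j).
Qed.

(** A row index is a tuple of coordinates and a partial transposition exchanges
    coordinates one by one, so the constraints split over the tensor factors. *)
Lemma card_index_assignments x s :
  #|[set a : {ffun 'I_L.+1 -> 'I_(tdim d)} | [forall i,
      midx_mix (x i) (a i) (a (ordS i)) ==
      midx_mix (x (s i)) (a (ordS (s i))) (a (s i))]]%SET| =
  (\prod_j d j ^ nwires (fun i => x i j) s)%N.
Proof.
pose F (j : 'I_n) := [set q : {ffun 'I_L.+1 -> 'I_(d j)} | [forall i,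
   q (slot_out (fun i => x i j) i) == q ((slot_in (fun i => x i j) \o s) i)]]%SET.
have FE j : #|F j| = (d j ^ nwires (fun i => x i j) s)%N by rewrite card_glued card_ord.
under eq_bigr => j _ do rewrite -FE.
transitivity #|(family (fun j => mem (F j)) : simpl_pred {dffun forall j : 'I_n, {ffun 'I_L.+1 -> 'I_(d j)}})|.
  rewrite -(on_card_preimset (f := coordinates)); last exact: onW_bij.
  apply: eq_card => a; rewrite !inE; apply/forallP/familyP => H.
    move=> j; rewrite inE; apply/forallP => i; have /eqP/(congr1 (fun b => midx_of b j)) := H i.
    rewrite !midx_mixE !ffunE /slot_out /slot_in /=.
    by case: (x i j); case: (x (s i) j) => ->.
  move=> i; rewrite -(inj_eq (can_inj (@midx_ofK n d))); apply/eqP/ffunP => j.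
  have := H j; rewrite inE => /forallP/(_ i)/eqP.
  rewrite !midx_mixE !ffunE /slot_out /slot_in /=.
  by case: (x i j); case: (x (s i) j).
rewrite card_family foldrE big_map [LHS]big_enum //.
Qed.
End IndexCount.

(** * The exact moment formula *)

Section ExactMoments.
Context {disp : measure_display} {T : measurableType disp} {R : realType}.
Variables (P : probability T R) (n : nat) (d : 'I_n -> nat) (p : nat).
Variables (G : T -> 'M[R[i]]_(tdim d, p)) (c : R) (B : {set {ffun 'I_n -> bool}}).
Hypothesis GG : gaussian_matrix P G.
Hypotheses (d_gt0 : forall j, (0 < d j)%N) (p_gt0 : (0 < p)%N).
Variable L : nat.
Local Notation D := (tdim d).
Local Notation word := {ffun 'I_L.+1 -> {ffun 'I_n -> bool}}.
Local Notation ratio := (p%:R / D%:R : R).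

Definition fixed_weight (s : 'S_L.+1) : R :=
  \prod_i (if s i == i then 1 - c / ratio else 1).

(** By genus_le this is a product of powers of the d j whose exponents are at most
    0; the quotients keep natural numbers in the exponents. *)
Definition genus_weight (s : 'S_L.+1) (x : word) : R :=
  \prod_j ((d j)%:R ^+ (ncycles s + nwires (fun i => x i j) s) / (d j)%:R ^+ L.+2).

Let D_gt0 : (0 < D)%N.
Proof. by apply: prodn_gt0. Qed.

Let DC0 : D%:R != 0 :> R[i].
Proof. by rewrite pnatr_eq0 -lt0n. Qed.

Let g (ij : 'I_D * 'I_p) w := G w ij.1 ij.2.

(* The diagonal entry c of the subtracted matrix is spread evenly over the p
   columns: c = D^-1 * (p * t). *)
Let t : R := c / ratio.

Let out_row (x : word) (a : {ffun 'I_L.+1 -> 'I_D}) i := midx_mix (x i) (a i) (a (ordS i)).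
Let in_row (x : word) (a : {ffun 'I_L.+1 -> 'I_D}) i := midx_mix (x i) (a (ordS i)) (a i).

Let slot_term (x : word) a (k : {ffun 'I_L.+1 -> 'I_p}) w i : R[i] :=
  g (out_row x a i, k i) w * ((g (in_row x a i, k i) w)^*)%C -
    t%:C%C * ((out_row x a i, k i) == (in_row x a i, k i))%:R.

Let centered_entry (x : word) (a : {ffun 'I_L.+1 -> 'I_D}) w i :
  (ptranspose (x i) (wishart (G w)) - (c%:C%C)%:M) (a i) (a (ordS i)) =
  \sum_k D%:R^-1 * (g (out_row x a i, k) w * ((g (in_row x a i, k) w)^*)%C -
    t%:C%C * ((out_row x a i, k) == (in_row x a i, k))%:R).
Proof.
rewrite -mulr_sumr sumrB !mxE ptransposeE !mxE mulrBr; congr (_ - _).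
  by congr (_ * _); apply: eq_bigr => k _; rewrite !mxE.
rewrite -mulr_sumr.
under eq_bigr => k _ do rewrite xpair_eqE eqxx andbT midx_mix_eq.
rewrite sumr_const card_ord -[_%:R *+ p]mulr_natr mulrCA.
have -> : t%:C%C = c%:C%C * (D%:R / p%:R) :> R[i].
  by rewrite /t invf_div rmorphM /= rmorphM fmorphV !rmorph_nat.
case: (a i == a (ordS i)); last by rewrite mulr0n mul0r !mulr0.
have p0 : p%:R != 0 :> R[i] by rewrite pnatr_eq0 -lt0n.
by rewrite mulr1n mul1r; field; rewrite DC0 p0.
Qed.

Let ntrace_expand w : ntrace (wishart_sum c B (G w) ^+ L.+1) =
  ((Num.sqrt #|B|%:R)^-1)%:C%C ^+ L.+1 * D%:R ^- L.+2 *
  \sum_(a : {ffun 'I_L.+1 -> 'I_D}) \sum_(x : word | x \in ffun_on (mem B))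
    \sum_(k : {ffun 'I_L.+1 -> 'I_p}) \prod_i slot_term x a k w i.
Proof.
rewrite /ntrace mxtrace_pow (exprS D%:R) invfM -[RHS]mulrA [RHS]mulrCA -[RHS]mulrA; congr (_ * _).
rewrite mulrCA [X in _ = _ * X]mulr_sumr mulr_sumr; apply: eq_bigr => a _.
under eq_bigr => i _ do rewrite mxE summxE.
rewrite big_split /= prodr_const card_ord; congr (_ * _).
rewrite bigA_distr_big mulr_sumr; apply: eq_bigr => x _.
under eq_bigr => i _ do rewrite centered_entry.
rewrite bigA_distr_bigA mulr_sumr; apply: eq_bigr => k _.
by rewrite big_split /= prodr_const card_ord exprVn.
Qed.

Let count_columns (s : 'S_L.+1) :
  \sum_(k : {ffun 'I_L.+1 -> 'I_p}) \prod_i (k i == k (s i))%:R = p%:R ^+ ncycles s :> R[i].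
Proof.
rewrite -natrX -[in RHS](card_ord p) -card_glued -sum1_card natr_sum [RHS]big_mkcond /=.
apply: eq_bigr => k _; rewrite inE.
case: forallP => [H|/forallP/forallPn[i /negbTE ni]].
  by rewrite big1 // => i _; rewrite (eqP (H i)) eqxx.
by rewrite (bigD1 i) //= ni mul0r.
Qed.

Let count_rows (s : 'S_L.+1) (x : word) :
  \sum_(a : {ffun 'I_L.+1 -> 'I_D}) \prod_i (out_row x a i == in_row x a (s i))%:R =
  \prod_j (d j)%:R ^+ nwires (fun i => x i j) s :> R[i].
Proof.
under [RHS]eq_bigr => j _ do rewrite -natrX.
rewrite -natr_prod -card_index_assignments -sum1_card natr_sum [RHS]big_mkcond /=.
apply: eq_bigr => a _; rewrite inE.
case: forallP => [H|/forallP/forallPn[i /negbTE ni]].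
  by rewrite big1 // => i _; rewrite /out_row /in_row (eqP (H i)) eqxx.
by rewrite (bigD1 i) //= /out_row /in_row ni mul0r.
Qed.

(** The trace is expanded over closed walks, words and column indices; the Wick
    formula for centred products exchanges the expectation for a sum over
    permutations, and the sums over columns and over rows then count free
    indices. *)
Theorem expected_moment : expected_ntrace P (fun w => wishart_sum c B (G w) ^+ L.+1) =
  ((Num.sqrt #|B|%:R)^-1 ^+ L.+1 * \sum_(s : 'S_L.+1) fixed_weight s * ratio ^+ ncycles s *
     \sum_(x : word | x \in ffun_on (mem B)) genus_weight s x)%:C%C.
Proof.
have [gG gI] := GG.
have gG' ij : std_complex_gaussian P (g ij) by exact: gG.
have int_k x a k : cintegrable P (fun w => \prod_i slot_term x a k w i).
  exact: (cintegrable_centered gG' gI t%:C%C (fun i => (out_row x a i, k i)) (fun i => (in_row x a i, k i))).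
have int_x x a : cintegrable P (fun w => \sum_k \prod_i slot_term x a k w i).
  by apply: cintegrable_sum => k _; exact: int_k.
have int_a a : cintegrable P (fun w => \sum_(x : word | x \in ffun_on (mem B))
    \sum_k \prod_i slot_term x a k w i).
  by apply: cintegrable_sum => x _; exact: int_x.
rewrite /expected_ntrace; under eq_fun do rewrite ntrace_expand.
rewrite cexpectationZ; last by apply: cintegrable_sum => a _; exact: int_a.
rewrite cexpectation_sum; last by move=> a _; exact: int_a.
under eq_bigr => a _.
  rewrite cexpectation_sum; last by move=> x _; exact: int_x.
  under eq_bigr => x _.
    rewrite cexpectation_sum; last by move=> k _; exact: int_k.
    under eq_bigr => k _.
      rewrite (centered_wick gG' gI t%:C%C (fun i => (out_row x a i, k i)) (fun i => (in_row x a i, k i))).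
      under eq_bigr => s _.
        under [X in _ * X]eq_bigr => i _ do rewrite xpair_eqE -mulnb natrM.
        rewrite big_split /=.
        over.
      over.
    rewrite exchange_big /=.
    under eq_bigr => s _ do rewrite -mulr_sumr -mulr_sumr count_columns.
    over.
  over.
rewrite exchange_big /=.
under eq_bigr => x _.
  rewrite exchange_big /=.
  under eq_bigr => s _ do rewrite -mulr_sumr -mulr_suml count_rows.
  over.
rewrite exchange_big /=.
have fw (s : 'S_L.+1) : \prod_i (if s i == i then 1 - t%:C%C else 1) = (fixed_weight s)%:C%C :> R[i].
  rewrite /fixed_weight rmorph_prod; apply: eq_bigr => i _.
  by case: ifP => _; rewrite ?rmorphB ?rmorph1.
have gw (s : 'S_L.+1) (x : word) : (D%:R ^+ L.+2)^-1 * (\prod_j (d j)%:R ^+ nwires (fun i => x i j) s * p%:R ^+ ncycles s)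
    = (ratio ^+ ncycles s * genus_weight s x)%:C%C :> R[i].
  transitivity (((D%:R ^+ L.+2)^-1 * (\prod_j (d j)%:R ^+ nwires (fun i => x i j) s *
      p%:R ^+ ncycles s) : R)%:C%C).
    rewrite [RHS]rmorphM fmorphV rmorphXn rmorph_nat; congr (_ * _).
    rewrite [RHS]rmorphM rmorphXn rmorph_nat rmorph_prod; congr (_ * _).
    by apply: eq_bigr => j _; rewrite rmorphXn rmorph_nat.
  congr (_%:C%C).
  have DX m : \prod_(j < n) (d j)%:R ^+ m = D%:R ^+ m :> R by rewrite prodrXl -natr_prod.
  have D0 : D%:R != 0 :> R by rewrite pnatr_eq0 -lt0n.
  have -> : genus_weight s x = D%:R ^+ ncycles s *
      \prod_j (d j)%:R ^+ nwires (fun i => x i j) s * (D%:R ^+ L.+2)^-1.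
    transitivity (\prod_j (d j)%:R ^+ ncycles s *
        \prod_j (d j)%:R ^+ nwires (fun i => x i j) s * \prod_j ((d j)%:R ^+ L.+2)^-1 : R).
      by rewrite -!big_split; apply: eq_bigr => j _; rewrite exprD.
    congr (_ * _ * _); first exact: DX.
    by rewrite prodfV; congr (_^-1); exact: DX.
  rewrite expr_div_n; field.
  by rewrite !expf_neq0.
under eq_bigr => s _ do under eq_bigr => x _ do rewrite fw.
rewrite [RHS]rmorphM rmorphXn -mulrA; congr (_ * _).
rewrite mulr_sumr rmorph_sum; apply: eq_bigr => s _.
rewrite [fixed_weight s * _ * _]mulr_sumr rmorph_sum mulr_sumr; apply: eq_bigr => x _.
by rewrite mulrCA gw -[in RHS]mulrA [RHS]rmorphM.
Qed.

End ExactMoments.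

(** * Bounds for one tuple of dimensions *)

Section MinDim.
Variables (n : nat) (d : 'I_n -> nat).

Lemma min_dim_le j : (min_dim d <= d j)%N.
Proof.
rewrite /min_dim; move: (\max_(j < n) d j)%N => x0.
have : j \in index_enum 'I_n by rewrite mem_index_enum.
elim: (index_enum _) => // i r IH; rewrite inE big_cons => /orP[/eqP<-|/IH H].
  exact: geq_minl.
exact: leq_trans (geq_minr _ _) H.
Qed.

Lemma min_dim_gt0 : (0 < n)%N -> (forall j, (0 < d j)%N) -> (0 < min_dim d)%N.
Proof.
case: n d => // n' d' _ d0; rewrite /min_dim.
apply: (big_ind (fun x => 0 < x)%N) => [|x y x0 y0|i _] //; last by rewrite leq_min x0.
exact: leq_trans (d0 ord0) (leq_bigmax _).
Qed.
End MinDim.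

Section StageBounds.
Variables (R : realType) (n : nat) (d : 'I_n -> nat) (B : {set {ffun 'I_n -> bool}}) (L : nat).
Hypotheses (n_gt0 : (0 < n)%N) (d_ge2 : forall j, (2 <= d j)%N) (B_gt0 : (0 < #|B|)%N).
Local Notation word := {ffun 'I_L.+1 -> {ffun 'I_n -> bool}}.
Variable s : 'S_L.+1.
Local Notation gw := (genus_weight (R := R) d s).
Local Notation mu := ((min_dim d)%:R : R).
Local Notation b := (#|B|%:R : R).
Local Notation lam := ((Num.sqrt b)^-1 : R).

Let weight (x : word) j : R :=
  (d j)%:R ^+ (ncycles s + nwires (fun i => x i j) s) / (d j)%:R ^+ L.+2.

Let d0 j : 0 < (d j)%:R :> R.
Proof. by rewrite ltr0n; exact: leq_trans (d_ge2 j). Qed.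

Let weight_ge0 x j : 0 <= weight x j.
Proof. by rewrite divr_ge0 // exprn_ge0 // ltW. Qed.

Let weight_le1 x j : weight x j <= 1.
Proof.
rewrite ler_pdivrMr ?exprn_gt0 // mul1r ler_weXn2l ?genus_le //.
by rewrite ler1n; exact: leq_trans (d_ge2 j).
Qed.

Lemma genus_weight_ge0 x : 0 <= gw x.
Proof. by apply: prodr_ge0 => j _; exact: weight_ge0. Qed.

Lemma genus_weight_le1 x : gw x <= 1.
Proof. by apply: prodr_ile1 => j _; rewrite weight_ge0 weight_le1. Qed.

Let mu0 : 0 < mu.
Proof. by rewrite ltr0n min_dim_gt0 // => j; exact: leq_trans (d_ge2 j). Qed.

(** Every factor is at most 1, and the factor j has a negative exponent. *)
Lemma genus_weight_small (x : word) j :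
  (ncycles s + nwires (fun i => x i j) s != L.+2)%N -> gw x <= mu^-1.
Proof.
move=> ne; rewrite /genus_weight (bigD1 j) //= -[leRHS]mulr1; apply: ler_pM.
- exact: weight_ge0.
- by apply: prodr_ge0 => i _; exact: weight_ge0.
- apply: (@le_trans _ _ (d j)%:R^-1); last by rewrite lef_pV2 ?posrE // ler_nat min_dim_le.
  rewrite ler_pdivrMr ?exprn_gt0 // exprS mulrA mulVf ?mul1r ?gt_eqF //.
  apply: ler_weXn2l; first by rewrite ler1n; exact: leq_trans (d_ge2 j).
  by have := genus_le (fun i => x i j) s; move: ne; lia.
- by apply: prodr_ile1 => i _; rewrite weight_ge0 weight_le1.
Qed.

Lemma genus_weight_unstable (x : word) : ~~ [forall i, x i == x (s i)] -> gw x <= mu^-1.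
Proof.
move=> /forallPn[i xi].
have [j /eqP xij] : exists j, x i j != x (s i) j.
  apply/existsP; apply: contraR xi => /existsPn H; apply/eqP/ffunP => j.
  by have /negPn/eqP := H j.
apply: (@genus_weight_small x j); apply/eqP => E; apply: xij.
by rewrite (genus0_stable E).
Qed.

Let W : R := \sum_(x : word | x \in ffun_on (mem B)) gw x.

Let stable_words := [set x : word | (x \in ffun_on (mem B)) && [forall i, x i == x (s i)]]%SET.

Let card_stable : #|stable_words| = (#|B| ^ ncycles s)%N.
Proof. exact: card_glued_on. Qed.

Let b1 : 1 <= b.
Proof. by rewrite ler1n. Qed.

Let lam0 : 0 < lam.
Proof. by rewrite invr_gt0 sqrtr_gt0; exact: lt_le_trans b1. Qed.

Let lam1 : lam <= 1.
Proof.
by rewrite invf_le1 ?sqrtr_gt0 ?(lt_le_trans ltr01) // -[leLHS]sqrtr1 ler_wsqrtr.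
Qed.

Let lamX k : 0 <= lam ^+ k <= 1.
Proof. by apply/andP; split; [apply: exprn_ge0; exact: ltW|apply: exprn_ile1 => //; exact: ltW]. Qed.

Let card_words : #|[set x : word | x \in ffun_on (mem B)]%SET| = (#|B| ^ L.+1)%N.
Proof. by rewrite cardsE card_ffun_on card_ord. Qed.

Let sum_le (A : pred word) (F : word -> R) (e : R) : 0 <= e ->
  (forall x, A x -> x \in ffun_on (mem B)) -> (forall x, A x -> F x <= e) ->
  \sum_(x | A x) F x <= b ^+ L.+1 * e.
Proof.
move=> e0 AB Fe; apply: (@le_trans _ _ (\sum_(x in [set x : word | x \in ffun_on (mem B)]%SET) e)).
  rewrite big_mkcond [leRHS]big_mkcond; apply: ler_sum => x _; rewrite inE.
  by case: (boolP (A x)) => Ax; [rewrite (AB x Ax) Fe|case: ifP].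
by rewrite sumr_const card_words -[e *+ _]mulr_natl natrX.
Qed.

Lemma word_sum_ge0 : 0 <= W.
Proof. by apply: sumr_ge0 => x _; exact: genus_weight_ge0. Qed.

Lemma word_sum_le : W <= b ^+ L.+1.
Proof. by rewrite -[leRHS]mulr1; apply: sum_le => // x _; exact: genus_weight_le1. Qed.

Let unstable_sum : R := \sum_(x : word | (x \in ffun_on (mem B)) && ~~ [forall i, x i == x (s i)]) gw x.

Let split_W : W = \sum_(x in stable_words) gw x + unstable_sum.
Proof.
rewrite /W (bigID (fun x : word => [forall i, x i == x (s i)])) /=; congr (_ + _).
by apply: eq_bigl => x; rewrite [in RHS]inE.
Qed.

Let unstable_le : 0 <= unstable_sum <= b ^+ L.+1 / mu.
Proof.
apply/andP; split; first by apply: sumr_ge0 => x _; exact: genus_weight_ge0.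
apply: sum_le => [|x /andP[]|x /andP[_ ux]] //.
exact: genus_weight_unstable.
Qed.

(** The words that are not constant on the cycles contribute at most
    |B|^(L+1) / min_dim in total.  There are |B|^(ncycles s) others, of weight at most
    1: after normalisation this is at most lam when s is not an involution.  When s
    is an involution, it is exactly 1 if s is noncrossing, whereas if s has a
    crossing all these words have a negative exponent. *)
Lemma normalized_word_sum : (forall i, s i != i) ->
  `|lam ^+ L.+1 * W - (planar_pairing s)%:R| <= lam + 2 * (b ^+ L.+1 / mu).
Proof.
move=> ds; have [U0 U1] := andP unstable_le.
have e0 : 0 <= b ^+ L.+1 / mu by apply: divr_ge0; [exact: exprn_ge0|exact: ltW].
have l0 := ltW lam0.
have [/forallP/= ss|ninv] := boolP [forall i, s (s i) == i]; last first.
  have -> : planar_pairing s = false.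
    apply/negbTE; apply: contra ninv => /andP[/forallP H _]; apply/forallP => i.
    by have /andP[] := H i.
  rewrite subr0 ger0_norm; last first.
    by rewrite mulr_ge0 ?word_sum_ge0 //; case/andP: (lamX L.+1).
  (* a cycle count below (L + 1) / 2 leaves a positive power of lam *)
  have c2 : ((ncycles s).*2 <= L)%N.
    have := @nclasses_noninvolution _ s ds; rewrite card_ord ltnS; apply.
    by move=> H; case/negP: ninv; apply/forallP => i; rewrite H.
  have stab : lam ^+ L.+1 * \sum_(x in stable_words) gw x <= lam.
    apply: (@le_trans _ _ (lam ^+ L.+1 * b ^+ ncycles s)).
      apply: ler_wpM2l; first by case/andP: (lamX L.+1).
      rewrite -natrX -card_stable -sum1_card natr_sum; apply: ler_sum => x _.
      exact: genus_weight_le1.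
    have -> : b ^+ ncycles s = (lam ^+ (ncycles s).*2)^-1.
      rewrite -muln2 mulnC exprM exprVn sqr_sqrtr ?ler0n // exprVn invrK //.
    have -> : lam ^+ L.+1 = lam ^+ (ncycles s).*2 * lam ^+ (L - (ncycles s).*2).+1.
      by rewrite -exprD addnS subnKC.
    rewrite mulrAC mulfV ?mul1r ?expf_neq0 ?gt_eqF // exprS -[leRHS]mulr1.
    by apply: ler_wpM2l => //; case/andP: (lamX (L - (ncycles s).*2)).
  rewrite split_W mulrDr; apply: lerD => //.
  apply: (@le_trans _ _ unstable_sum); last by lra.
  by rewrite -[leRHS]mul1r; apply: ler_wpM2r => //; case/andP: (lamX L.+1).
have inv : involutive s by move=> i; apply/eqP.
have fpf : fpf_involution s by apply/forallP => i; rewrite ds ss.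
have c2 : ((ncycles s).*2 = L.+1)%N by have := nclasses_involution ds inv; rewrite card_ord.
have lamb : lam ^+ L.+1 * b ^+ ncycles s = 1.
  rewrite -c2 -muln2 mulnC exprM exprVn sqr_sqrtr ?ler0n // exprVn mulVf //.
  by rewrite expf_neq0 // gt_eqF // (lt_le_trans ltr01).
have lU : 0 <= lam ^+ L.+1 * unstable_sum <= b ^+ L.+1 / mu.
  have [l1 l2] := andP (lamX L.+1).
  rewrite mulr_ge0 //=; apply: le_trans U1.
  by rewrite -[leRHS]mul1r; apply: ler_wpM2r.
have [lU0 lU1] := andP lU.
have stable_genus (x : word) j : x \in stable_words -> nwires (fun i => x i j) s = nwires (fun=> false) s.
  rewrite inE => /andP[_ /forallP H]; apply: nwires_involution => // i.
  by rewrite -(eqP (H i)).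
rewrite split_W mulrDr /planar_pairing fpf /=.
have [nc|cr] := boolP (noncrossing s).
  have -> : \sum_(x in stable_words) gw x = b ^+ ncycles s.
    rewrite -natrX -card_stable -sum1_card natr_sum; apply: eq_bigr => x xs.
    rewrite /genus_weight big1 // => j _.
    by rewrite (stable_genus x j xs) (noncrossing_genus0 fpf nc) divff // expf_neq0 // gt_eqF.
  rewrite lamb addrAC subrr add0r ger0_norm //; lra.
have sS : 0 <= lam ^+ L.+1 * \sum_(x in stable_words) gw x <= b ^+ L.+1 / mu.
  have [l1 l2] := andP (lamX L.+1).
  have S0 : 0 <= \sum_(x in stable_words) gw x by apply: sumr_ge0 => x _; exact: genus_weight_ge0.
  rewrite mulr_ge0 //=; apply: (@le_trans _ _ (\sum_(x in stable_words) gw x)).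
    by rewrite -[leRHS]mul1r; apply: ler_wpM2r.
  apply: sum_le => [|x|x xs]; first by rewrite invr_ge0 ltW.
    by rewrite inE => /andP[].
  apply: (@genus_weight_small x (Ordinal n_gt0)); rewrite (stable_genus _ _ xs).
  by apply: contra cr => /eqP E; exact: genus0_noncrossing.
have [sS0 sS1] := andP sS.
rewrite subr0 ger0_norm ?addr_ge0 //; lra.
Qed.

End StageBounds.

(** * The limit of the moments *)

Lemma cvg_near_eq (U : topologicalType) (f g : nat -> U) (l : U) :
  (\forall k \near \oo, f k = g k) -> f k @[k --> \oo] --> l -> g k @[k --> \oo] --> l.
Proof. by move=> fg; apply: cvg_trans; exact: near_eq_cvg. Qed.

Lemma real_complex_cvg (R : realType) (f : nat -> R) (l : R) :
  f k @[k --> \oo] --> l -> (f k)%:C%C @[k --> \oo] --> (l%:C%C : R[i]^o).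
Proof.
move=> fl; apply/(@cvgrPdist_lt R[i] R[i]^o) => e e0.
have [eR Ee] : exists x : R, e = x%:C%C.
  exists (complex.Re e); rewrite [LHS]complexE; case: e e0 => a b.
  by rewrite ltcE /= => /andP[/eqP-> _]; rewrite mulr0 addr0.
rewrite Ee in e0 *; rewrite ltcR in e0.
near=> k; rewrite -rmorphB normc_def /= expr0n addr0 sqrtr_sqr ltcR.
by near: k; exact: (cvgrPdist_lt _ _).1 fl _ e0.
Unshelve. all: by end_near. Qed.

Section Limits.
(* the stage k stays an explicit argument of d *)
Unset Implicit Arguments.
Variables (R : realType) (c : R) (n p : nat -> nat) (d : forall k : nat, 'I_(n k) -> nat).
Variable B : forall k : nat, {set {ffun 'I_(n k) -> bool}}.
Set Implicit Arguments.
Hypotheses (c0 : 0 < c) (n0 : forall k, (0 < n k)%N) (d2 : forall k j, (2 <= d k j)%N).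
Hypothesis B_infty : #|B k| @[k --> \oo] --> \oo.
Local Notation r k := ((p k)%:R / (tdim (d k))%:R : R).
Local Notation b k := (#|B k|%:R : R).
Local Notation im k := ((min_dim (d k))%:R^-1 : R).
Local Notation lam k := ((Num.sqrt (b k))^-1 : R).
Hypothesis small : forall m : nat, b k ^+ m * (im k + `|r k - c|) @[k --> \oo] --> (0 : R).

Let im_small m : b k ^+ m * im k @[k --> \oo] --> (0 : R).
Proof.
apply: (squeeze_cvgr _ _ (small m)); last exact: cvg_cst.
apply: nearW => k; rewrite mulr_ge0 ?exprn_ge0 ?invr_ge0 //=.
by rewrite ler_wpM2l ?exprn_ge0 // lerDl.
Qed.

Let ratio_small m : b k ^+ m * (r k - c) @[k --> \oo] --> (0 : R).
Proof.
apply/norm_cvg0P; apply: (squeeze_cvgr _ _ (small m)); last exact: cvg_cst.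
apply: nearW => k; rewrite normr_ge0 /= normrM ger0_norm ?exprn_ge0 //.
by rewrite ler_wpM2l ?exprn_ge0 // lerDr invr_ge0.
Qed.

Let ratio_cvg : r k @[k --> \oo] --> c.
Proof.
apply/subr_cvg0; have := ratio_small 0.
by under eq_fun do rewrite expr0 mul1r.
Qed.

Let ratio_gt0 : \forall k \near \oo, 0 < r k.
Proof. exact: (cvgr_gt _ ratio_cvg). Qed.

Let B_gt0 : \forall k \near \oo, (0 < #|B k|)%N.
Proof. exact: (cvgnyPge _).1 B_infty 1%N. Qed.

Let lam_cvg0 : lam k @[k --> \oo] --> (0 : R).
Proof.
apply/gtr0_cvgV0.
  by near=> k; rewrite sqrtr_gt0 ltr0n; near: k; exact: B_gt0.
apply/cvgryPge => A; near=> k.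
have [A0|A0] := leP A 0; first exact: le_trans (sqrtr_ge0 _).
rewrite -[A]gtr0_norm // -sqrtr_sqr ler_wsqrtr //.
apply: ltW; apply: lt_le_trans (truncnS_gt _) _; rewrite ler_nat.
by near: k; exact: (cvgnyPge _).1 B_infty _.
Unshelve. all: by end_near. Qed.

Variable L : nat.
Local Notation W k s := (\sum_(x : {ffun 'I_L.+1 -> {ffun 'I_(n k) -> bool}} | x \in ffun_on (mem (B k)))
  genus_weight (R := R) (d k) s x).

Definition moment_term k (s : 'S_L.+1) : R :=
  lam k ^+ L.+1 * (fixed_weight (d k) (p k) c s * r k ^+ ncycles s * W k s).

Let cvg_pow (f : nat -> R) (l : R) m : f k @[k --> \oo] --> l -> f k ^+ m @[k --> \oo] --> l ^+ m.
Proof. by move=> fl; apply: (cvg_comp f (fun z => z ^+ m) fl); exact: exprn_continuous. Qed.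

Let fixed_factor_cvg0 : (1 - c / r k) @[k --> \oo] --> (0 : R).
Proof.
have cn : c != 0 by rewrite gt_eqF.
rewrite -[X in _ --> X](subrr 1); apply: cvgB; first exact: cvg_cst.
rewrite -[X in _ --> X](mulfV cn); apply: cvgM; first exact: cvg_cst.
exact: cvgV.
Qed.

Let fixed_factor_small m : b k ^+ m * (1 - c / r k) @[k --> \oo] --> (0 : R).
Proof.
have cV : (r k)^-1 @[k --> \oo] --> c^-1 by apply: cvgV => //; rewrite gt_eqF.
have H : b k ^+ m * (r k - c) * (r k)^-1 @[k --> \oo] --> (0 : R).
  by rewrite -[X in _ --> X](mul0r c^-1); apply: cvgM.
apply: (cvg_near_eq _ H).
apply: filterS ratio_gt0 => k rk.
by rewrite /= -mulrA mulrBl divff // gt_eqF.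
Qed.

Let cvg_prod_fixed (A : pred 'I_L.+1) (s : 'S_L.+1) : exists l : R,
  \prod_(i | A i) (if s i == i then 1 - c / r k else 1) @[k --> \oo] --> l.
Proof.
rewrite /index_enum; elim: (Finite.enum _) => [|i q [l IH]].
  by exists 1; under eq_fun do rewrite big_nil; exact: cvg_cst.
case Ai: (A i); last by exists l; under eq_fun do rewrite big_cons Ai.
exists ((if s i == i then 0 else 1) * l); under eq_fun do rewrite big_cons Ai.
by apply: cvgM => //; case: (s i == i) => //; exact: cvg_cst.
Qed.

Let word_sum_bounds k (s : 'S_L.+1) : (0 < #|B k|)%N -> 0 <= lam k ^+ L.+1 * W k s <= b k ^+ L.+1.
Proof.
move=> Bk.
have W0 := word_sum_ge0 R (d k) (B k) s.
have W1 := word_sum_le R (B k) (@d2 k) s.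
have l0 : 0 <= lam k by rewrite invr_ge0 sqrtr_ge0.
have l1 : lam k <= 1.
  by rewrite invf_le1 ?sqrtr_gt0 ?ltr0n // -[leLHS]sqrtr1 ler_wsqrtr // ler1n.
rewrite mulr_ge0 ?exprn_ge0 //=; apply: le_trans W1; rewrite -[leRHS]mul1r ler_wpM2r //.
exact: exprn_ile1.
Qed.

(** Without fixed points this is normalized_word_sum.  A fixed point contributes
    the factor 1 - c / r, which beats the bound |B|^(L+1) of the word sum, while the
    factors of the other fixed points stay bounded. *)
Lemma moment_term_cvg (s : 'S_L.+1) :
  moment_term k s @[k --> \oo] --> (planar_pairing s)%:R * c ^+ ncycles s.
Proof.
have [/forallP/= ds|/forallPn[i /negPn/eqP si]] := boolP [forall i, s i != i].
  have wE k : fixed_weight (d k) (p k) c s = 1.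
    by rewrite /fixed_weight big1 // => i _; rewrite (negbTE (ds i)).
  have -> : (fun k => moment_term k s) = (fun k => (lam k ^+ L.+1 * W k s) * r k ^+ ncycles s).
    by apply/funext => k; rewrite /moment_term wE mul1r mulrCA mulrC.
  apply: cvgM; last exact: cvg_pow.
  apply/subr_cvg0/norm_cvg0P.
  have e0 : lam k + 2 * (b k ^+ L.+1 * im k) @[k --> \oo] --> (0 : R).
    rewrite -[X in _ --> X]addr0 -[X in _ + X](mulr0 2).
    by apply: cvgD => //; apply: cvgM; [exact: cvg_cst|exact: im_small].
  apply: (squeeze_cvgr _ _ e0); last exact: cvg_cst.
  near=> k; rewrite normr_ge0 /=; apply: normalized_word_sum => //.
  by near: k; exact: B_gt0.
have -> : planar_pairing s = false.
  by apply/negbTE/negP => /andP[/forallP/(_ i)]; rewrite si eqxx.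
rewrite mul0r; apply/norm_cvg0P.
have [l Hl] := cvg_prod_fixed (fun i' => i' != i) s.
pose u k := (b k ^+ L.+1 * (1 - c / r k)) *
  ((\prod_(i' | i' != i) (if s i' == i' then 1 - c / r k else 1)) * r k ^+ ncycles s).
have u0 : `|u k| @[k --> \oo] --> (0 : R).
  apply/norm_cvg0P; rewrite -[X in _ --> X](mul0r (l * c ^+ ncycles s)).
  by apply: cvgM; [exact: fixed_factor_small|apply: cvgM => //; exact: cvg_pow].
apply: (squeeze_cvgr _ _ u0); last exact: cvg_cst.
near=> k; rewrite normr_ge0 /=.
have Bk : (0 < #|B k|)%N by near: k; exact: B_gt0.
have [S0 S1] := andP (word_sum_bounds s Bk).
rewrite /moment_term /u /fixed_weight (bigD1 i) //= si eqxx.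
set pr := \prod_(_ | _) _.
rewrite (_ : _ * (_ * _) = (lam k ^+ L.+1 * W k s) * ((1 - c / r k) * (pr * r k ^+ ncycles s))); last by ring.
rewrite -[X in _ <= `|X|]mulrA [leLHS]normrM [leRHS]normrM ler_wpM2r //.
by rewrite ger0_norm // ger0_norm ?exprn_ge0.
Unshelve. all: by end_near. Qed.

(** A planar pairing of L + 1 points has (L + 1) / 2 cycles, so there is none when
    L + 1 is odd. *)
Lemma planar_sum : \sum_(s : 'S_L.+1) (planar_pairing s)%:R * c ^+ ncycles s = semicircle_moment c L.+1.
Proof.
have c2 (s : 'S_L.+1) : planar_pairing s -> ((ncycles s).*2 = L.+1)%N.
  move=> /andP[/forallP H _].
  have ds i : s i != i by case/andP: (H i).
  have ss : involutive s by move=> i; apply/eqP; case/andP: (H i).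
  by have := nclasses_involution ds ss; rewrite card_ord.
have [oL|eL] := boolP (odd L.+1).
  rewrite semicircle_moment_odd // big1 // => s _.
  case: (boolP (planar_pairing s)) => [/c2 E|_]; last by rewrite mul0r.
  by move: oL; rewrite -E odd_double.
have E : (L.+1 = L.+1./2.*2)%N by rewrite -[LHS]odd_double_half (negbTE eL).
rewrite [in RHS]E semicircle_moment_even // -E.
transitivity (\sum_(s : 'S_L.+1 | planar_pairing s) c ^+ L.+1./2).
  rewrite [RHS]big_mkcond; apply: eq_bigr => s _.
  case: (boolP (planar_pairing s)) => [/c2 Es|_]; last by rewrite mul0r.
  by rewrite mul1r; congr (_ ^+ _); rewrite -Es doubleK.
rewrite sumr_const -[LHS]mulr_natr; congr (_ * _%:R).
Qed.

Lemma moment_cvg : \sum_s moment_term k s @[k --> \oo] --> semicircle_moment c L.+1.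
Proof.
rewrite -planar_sum.
rewrite /index_enum; elim: (Finite.enum _) => [|s q IH].
  by under eq_fun do rewrite big_nil; rewrite big_nil; exact: cvg_cst.
under eq_fun do rewrite big_cons; rewrite big_cons.
by apply: cvgD => //; exact: moment_term_cvg.
Qed.

Lemma eventually_nondegenerate : \forall k \near \oo, (0 < p k)%N.
Proof.
near=> k; have : 0 < r k by near: k; exact: ratio_gt0.
by rewrite lt0n; apply: contraTneq => ->; rewrite mul0r ltxx.
Unshelve. all: by end_near. Qed.

End Limits.

Theorem theorem3p6 (R : realType) (c : R)
    (n p : nat -> nat) (d : forall k : nat, 'I_(n k) -> nat)
    (B : forall k : nat, {set {ffun 'I_(n k) -> bool}})
    (disp : nat -> measure_display)
    (T : forall k : nat, measurableType (disp k))
    (P : forall k : nat, probability (T k) R)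
    (G : forall k : nat, T k -> 'M[R[i]]_(tdim (d k), p k)) :
  0 < c ->
  (forall k, (0 < n k)%N) ->
  (forall k (j : 'I_(n k)), (2 <= d k j)%N) ->
  (forall k, gaussian_matrix (P k) (G k)) ->
  #|B k| @[k --> \oo] --> \oo ->
  (forall m : nat,
    (#|B k|%:R ^+ m *
       ((min_dim (d k))%:R^-1 + `|(p k)%:R / (tdim (d k))%:R - c|) : R)
      @[k --> \oo] --> (0 : R)) ->
  forall m : nat,
    expected_ntrace (P k) (fun w => wishart_sum c (B k) (G k w) ^+ m)
      @[k --> \oo] --> ((semicircle_moment c m)%:C%C : R[i]^o).
Proof.
move=> c0 n0 d2 GG B_infty small [|L].
  have E k : expected_ntrace (P k) (fun w => wishart_sum c (B k) (G k w) ^+ 0) = 1%:C%C.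
    rewrite /expected_ntrace.
    have -> : (fun w => ntrace (wishart_sum c (B k) (G k w) ^+ 0)) = (fun=> 1%:C%C).
      apply/funext => w; rewrite expr0 /ntrace mxtrace1 mulVf // pnatr_eq0 -lt0n.
      by apply: prodn_gt0 => j; exact: leq_trans (d2 k j).
    by rewrite cexpectation_real Rintegral_probability1.
  rewrite semicircle_moment0 //.
  apply: (@cvg_near_eq R[i]^o (fun=> 1%:C%C)); last exact: cvg_cst.
  by apply: nearW => k; rewrite E.
have H := real_complex_cvg (moment_cvg c0 n0 d2 B_infty small (L := L)).
apply: (@cvg_near_eq R[i]^o _ _ _ _ H); near=> k; apply/esym.
rewrite (expected_moment c (B k) (GG k)) //.
- by rewrite /moment_term -mulr_sumr.
- by move=> j; exact: leq_trans (d2 k j).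
- by near: k; exact: eventually_nondegenerate c0 small.
Unshelve. all: by end_near. Qed.
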